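(* Let $\mathcal{M}$ be an acyclic oriented matroid on a finite ground set and let $(\mathcal{F},\mathcal{M})$ be a facial building set with $\kappa(\mathcal{F})=\{F_1,\dots,F_k\}$. Then the facial nested complex of $(\mathcal{F},\mathcal{M})$ is isomorphic to $\mathcal{L}\bigl(\mathrm{sd}(\mathcal{F}_{\le F_1}\boxplus\dots\boxplus\mathcal{F}_{\le F_k},\ \mathcal{M}_{|F_1}\boxplus\dots\boxplus\mathcal{M}_{|F_k})\bigr)_{<\hat1}$.
   Context: An oriented matroid $\mathcal{M}$ on $S$ is acyclic if $(S,\varnothing)$ is a covector. A face of an acyclic $\mathcal{M}$ is a set $F\subseteq S$ such that $(S\setminus F,\varnothing)$ is a covector. The faces ordered by inclusion form the Las Vergnas face lattice $\mathcal{L}(\mathcal{M})$, with bottom $\varnothing$ and top $\hat1=S$; the face semilattice is $\mathcal{L}(\mathcal{M})_{<\hat 1}$ (by convention $\{\varnothing\}$ if the ground set is empty). $\mathcal{M}_{|R}$ and $\mathcal{M}_{/R}$ denote the usual restriction to $R$ and contraction of $R$, and $\oplus$ the usual direct sum of oriented matroids. For a finite lattice $\mathcal{L}$, an $\mathcal{L}$-building set is a subset $\mathcal{F}\subseteq\mathcal{L}_{>\hat 0}$ such that for every $Y\in\mathcal{L}_{>\hat 0}$, with $\{B_1,\dots,B_k\}=\max(\mathcal{F}_{\le Y})$, there is a poset isomorphism $\prod_{j}\mathcal{L}_{\le B_j}\to\mathcal{L}_{\le Y}$ whose $j$-th component is the inclusion. Let $\kappa(\mathcal{F})=\max(\mathcal{F})$;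 $\mathcal{F}$ is connected if $|\kappa(\mathcal{F})|=1$. An $\mathcal{L}$-nested set on $\mathcal{F}$ is a subset $\mathcal{N}\subseteq\mathcal{F}$ containing $\kappa(\mathcal{F})$ such that for any $k\ge2$ pairwise incomparable $B_1,\dots,B_k\in\mathcal{N}\setminus\kappa(\mathcal{F})$, the join $B_1\vee\cdots\vee B_k$ is not in $\mathcal{F}$. The $\mathcal{L}$-nested complex of $\mathcal{F}$ is the simplicial complex with faces $\mathcal{N}\setminus\kappa(\mathcal{F})$. A facial building set is a pair $(\mathcal{F},\mathcal{M})$ with $\mathcal{F}$ an $\mathcal{L}(\mathcal{M})$-building set; its facial nested complex is the $\mathcal{L}(\mathcal{M})$-nested complex of $\mathcal{F}$. We write $\mathcal{F}_{\le F}=\{G\in\mathcal{F}:G\subseteq F\}$, which is a facial building set for $\mathcal{M}_{|F}$ if $F\in\mathcal{F}$. Stellar subdivision: for a proper face $F$ of an acyclic oriented matroid $\mathcal{M}$ on $S$, a stellar subdivision $\mathrm{sd}(F,\mathcal{M})$ is any acyclic oriented matroid on $S\cup\{a_F\}$ whose proper faces are exactly (i) the proper faces $G$ of $\mathcal{M}$ with $G\not\supseteq F$, and (ii) the sets $\{a_F\}\cup G$ where $G$ is a proper face of $\mathcal{M}$ with $G\not\supseteq F$ such that some proper face of $\mathcal{M}$ contains $F\cup G$. It exists, and its face semilattice is uniquely determined. Free sum: for acyclic oriented matroids $\mathcal{M},\mathcal{M}'$ on disjoint ground sets $S,S'$, a free sum $\mathcal{M}\boxplus\mathcal{M}'$ is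 an oriented matroid on $S\cup S'$ of the form $\mathrm{sd}(S,\mathcal{M}\oplus\mathcal{M}')_{/a_S}$; its proper faces are the sets $G\cup G'$ with $G\ne S$ a face of $\mathcal{M}$ and $G'\neq S'$ a face of $\mathcal{M}'$. For connected facial building sets $\mathcal{F}$ for $\mathcal{M}$ and $\mathcal{F}'$ for $\mathcal{M}'$, $\mathcal{F}\boxplus\mathcal{F}'=(\mathcal{F}\setminus\{S\})\cup(\mathcal{F}'\setminus\{S'\})\cup\{S\cup S'\}$, a connected facial building set for $\mathcal{M}\boxplus\mathcal{M}'$. Both operations are iterated for more than two summands. For a connected facial building set $\mathcal{F}$ for an acyclic oriented matroid $\mathcal{M}$ on $S$, $\mathrm{sd}(\mathcal{F},\mathcal{M})$ is the restriction of $\mathrm{sd}(G_1,\mathrm{sd}(G_2,\dots\mathrm{sd}(G_m,\mathcal{M})\dots))$ to the set of new elements $\{a_{G}: G\in\mathcal{F}\setminus\{S\}\}$, where $G_1,\dots,G_m$ are the elements of $\mathcal{F}\setminus\{S\}$ ordered in any way such that $G_i\subseteq G_j$ implies $i\le j$ (so larger faces are subdivided first), and where $a_G$ is relabeled by $G$. *)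

(* Defs.v *)
From mathcomp Require Import all_boot.

Set Implicit Arguments.
Unset Strict Implicit.
Unset Printing Implicit Defensive.

Section SignedSets.
Variable U : finType.

(* The signed set (X.1, X.2) has positive part X.1 and negative part X.2. *)
Definition signed_set : finType := ({set U} * {set U})%type.

Implicit Types X Y : signed_set.

Definition signed_on (S : {set U}) X : bool :=
  [&& X.1 \subset S, X.2 \subset S & [disjoint X.1 & X.2]].

Definition ss0 : signed_set := (set0, set0).

Definition ssopp X : signed_set := (X.2, X.1).

Definition sscomp X Y : signed_set :=
  (X.1 :|: (Y.1 :\: X.2), X.2 :|: (Y.2 :\: X.1)).

Definition separation X Y : {set U} := (X.1 :&: Y.2) :|: (X.2 :&: Y.1).

Definition ssrestr (R : {set U}) X : signed_set := (X.1 :&: R, X.2 :&: R).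

Definition ssunion X Y : signed_set := (X.1 :|: Y.1, X.2 :|: Y.2).

End SignedSets.

Definition ssimage (U V : finType) (f : U -> V) (X : signed_set U) :
    signed_set V := (f @: X.1, f @: X.2).

Definition sspreimage (U V : finType) (f : U -> V) (X : signed_set V) :
    signed_set U := (f @^-1: X.1, f @^-1: X.2).

(* The universe U is only a reservoir of names: the elements of the matroid
   are those of [ground]. *)
Record covector_system (U : finType) := CovectorSystem {
  ground : {set U};
  covectors : {set signed_set U}
}.

Section OrientedMatroids.
Variable U : finType.
Implicit Types (M N : covector_system U) (F G R : {set U}).

Definition oriented_matroid M : Prop :=
  [/\ forall X, X \in covectors M -> signed_on (ground M) X,
      ss0 U \in covectors M,
      forall X, X \in covectors M -> ssopp X \in covectors M,
      forall X Y, X \in covectors M -> Y \in covectors M ->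
        sscomp X Y \in covectors M
    & forall X Y e, X \in covectors M -> Y \in covectors M ->
        e \in separation X Y ->
        exists Z, [/\ Z \in covectors M, e \notin Z.1 :|: Z.2
          & forall f, f \notin separation X Y ->
              (f \in Z.1) = (f \in (sscomp X Y).1) /\
              (f \in Z.2) = (f \in (sscomp X Y).2)]].

Definition acyclic M : Prop := (ground M, set0) \in covectors M.

Definition faces M : {set {set U}} :=
  [set F : {set U} | (F \subset ground M) && ((ground M :\: F, set0) \in covectors M)].

Definition proper_faces M : {set {set U}} := faces M :\ ground M.

Definition face_semilattice M : {set {set U}} :=
  if ground M == set0 then [set set0] else proper_faces M.

Definition restriction M R : covector_system U :=
  CovectorSystem (ground M :&: R) [set ssrestr R X | X in covectors M].

Definition contraction M R : covector_system U :=
  CovectorSystem (ground M :\: R)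
    [set X in covectors M | [disjoint X.1 :|: X.2 & R]].

(* Meaningful only for disjoint ground sets. *)
Definition direct_sum M N : covector_system U :=
  CovectorSystem (ground M :|: ground N)
    [set ssunion X Y | X in covectors M, Y in covectors N].

Definition empty_om : covector_system U :=
  CovectorSystem set0 [set ss0 U].

(* N is a stellar subdivision sd(F, M), with new element a. *)
Definition is_stellar_subdivision (a : U) F M N : Prop :=
  [/\ F \in proper_faces M, a \notin ground M & ground N = a |: ground M] /\
  [/\ oriented_matroid N, acyclic N
    & proper_faces N =
        [set G in proper_faces M | ~~ (F \subset G)] :|:
        [set a |: G | G in proper_faces M &
           ~~ (F \subset G) &&
           [exists H in proper_faces M, F :|: G \subset H]]].

End OrientedMatroids.

(* Both relabelings are meant for an injective f. *)
Definition relabel (U V : finType) (f : U -> V) (M : covector_system U) :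
    covector_system V :=
  CovectorSystem (f @: ground M)
    [set ssimage f X | X in covectors M].

(* Inverse relabeling, when the ground set of M is contained in the image
   of f. *)
Definition unrelabel (U V : finType) (f : U -> V) (M : covector_system V) :
    covector_system U :=
  CovectorSystem (f @^-1: ground M)
    [set sspreimage f X | X in covectors M].

Definition poset_iso (S T : finType) (leS : rel S) (leT : rel T)
    (A : {set S}) (B : {set T}) (f : S -> T) : Prop :=
  [/\ {in A &, injective f}, f @: A = B
    & {in A &, forall x y, leT (f x) (f y) = leS x y}].

Definition incl (U : finType) : rel {set U} := fun A B => A \subset B.

Definition isomorphic_by_inclusion (U V : finType)
    (A : {set {set U}}) (B : {set {set V}}) : Prop :=
  exists f, poset_iso (@incl U) (@incl V) A B f.

(* Here the finite lattice L is a family of sets ordered by inclusion, whose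
   bottom element is the empty set. *)
Section BuildingSets.
Variable U : finType.
Implicit Types (L F A N : {set {set U}}) (B G J Y : {set U}).

Definition below F Y : {set {set U}} := [set G in F | G \subset Y].

Definition kappa F : {set {set U}} := [set B | maxset (fun C => C \in F) B].

(* The product of the L_{<= B} for B in A; a family indexed by A is extended
   by the empty set outside of A. *)
Definition below_prod L A : {set {ffun {set U} -> {set U}}} :=
  [set x | x \in pfamily set0 A (fun B => below L B)].

Definition le_family (x y : {ffun {set U} -> {set U}}) : bool :=
  [forall B, x B \subset y B].

Definition in_component B G : {ffun {set U} -> {set U}} :=
  [ffun C => if C == B then G else set0].

Definition building_set L F : Prop :=
  F \subset L :\ set0 /\
  forall Y, Y \in L :\ set0 ->
    let A := kappa (below F Y) in
    exists phi : {ffun {set U} -> {set U}} -> {set U},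
      poset_iso le_family (@incl U) (below_prod L A) (below L Y) phi /\
      forall B G, B \in A -> G \in below L B -> phi (in_component B G) = G.

Definition is_join L A J : bool :=
  [&& J \in L, cover A \subset J
    & [forall G in L, (cover A \subset G) ==> (J \subset G)]].

Definition antichain A : bool :=
  [forall B in A, forall C in A, (B \subset C) ==> (B == C)].

Definition nested_set L F N : bool :=
  [&& kappa F \subset N, N \subset F
    & [forall A : {set {set U}},
        [&& A \subset N :\: kappa F, 1 < #|A| & antichain A] ==>
        [forall J in F, ~~ is_join L A J]]].

Definition nested_complex L F : {set {set {set U}}} :=
  [set N :\: kappa F | N in [set N | nested_set L F N]].

End BuildingSets.

Section FacialBuildingSets.
Variable U : finType.

Definition facial_pair : Type := ({set {set U}} * covector_system U)%type.

Implicit Types (M : covector_system U) (p q r : facial_pair).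

Definition facial_building_set p : Prop := building_set (faces p.2) p.1.

Definition facial_nested_complex p : {set {set {set U}}} :=
  nested_complex (faces p.2) p.1.

(* P is a free sum of M and M'; the auxiliary element a_S is None. *)
Definition is_free_sum M M' P : Prop :=
  [disjoint ground M & ground M'] /\
  exists2 N : covector_system (option U),
    is_stellar_subdivision None (Some @: ground M)
      (relabel Some (direct_sum M M')) N
    & P = unrelabel Some (contraction N [set None]).

Definition box_building p q : {set {set U}} :=
  (p.1 :\ ground p.2) :|: (q.1 :\ ground q.2) :|:
  [set ground p.2 :|: ground q.2].

Definition is_facial_free_sum p q r : Prop :=
  r.1 = box_building p q /\ is_free_sum p.2 q.2 r.2.

Fixpoint is_free_sum_from p (s : seq facial_pair) r : Prop :=
  if s is p' :: s' then
    exists2 q, is_facial_free_sum p p' q & is_free_sum_from q s' r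
  else r = p.

(* Iterated from left to right; the sum without summands is the oriented
   matroid on the empty set, with its unique building set. *)
Definition is_iterated_free_sum (s : seq facial_pair) r : Prop :=
  if s is p :: s' then is_free_sum_from p s' r else r = (set0, empty_om U).

(* N is sd(G_1, sd(G_2, ... sd(G_m, M))) for s = [:: G_1; ...; G_m]; an
   element e of M becomes inl e, and the new element a_G is inr G. *)
Fixpoint is_iterated_subdivision (s : seq {set U}) M
    (N : covector_system (U + {set U})%type) : Prop :=
  if s is G :: s' then
    exists2 N', is_iterated_subdivision s' M N'
      & is_stellar_subdivision (inr G) (inl @: G) N' N
  else N = relabel inl M.

(* Q is sd(F, M) for p = (F, M). *)
Definition is_sd p (Q : covector_system {set U}) : Prop :=
  let F := p.1 :\ ground p.2 in
  exists s N,
    [/\ perm_eq s (enum F),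
        {in s &, forall G H : {set U}, G \subset H -> index G s <= index H s},
        is_iterated_subdivision s p.2 N
      & Q = unrelabel inr (restriction N (inr @: F))].

End FacialBuildingSets.

(* Main.v *)
Require Import Defs.
From mathcomp Require Import all_boot.

Set Implicit Arguments.
Unset Strict Implicit.
Unset Printing Implicit Defensive.

(** Both complexes turn out to be the same family of sets, so that the
    isomorphism is the identity: a family A of non-maximal members of F is
    nested if and only if the new elements indexed by A form a proper face of
    the iterated subdivision.

    One stellar subdivision at H keeps the faces that do not contain H, and
    adds the new element to those that in addition lie with H in a common
    proper face. Iterating this (iterated_subdivisionP) gives a criterion that
    can be read off the subdivided lattice. List A along the order s, in which
    smaller faces come first, and form the increasing joins of its initial
    segments: A is a face if and only if each of these joins is proper and
    contains no member of F that comes later in s. Nested sets satisfy this,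
    because the join of a nested set contains only those members of F that lie
    below one of its elements (nested_below_closure); here the product
    decomposition of intervals is used. Conversely, if an antichain of at
    least two members of A had a join J in F, then J would come after the
    antichain and yet lie in its join (walk_no_join).

    A proper face of the free sum contains no maximal member of F, because it
    meets every summand in a proper face (free_sumP); as the factors of M are
    disjoint (kappa_disjoint), joins in the free sum are computed summand by
    summand (summandwise_closure). Every nonempty proper face of the free sum
    contains a subdivided face, so the proper faces of the final subdivision
    consist of new elements only. Restricting to the new elements then loses
    no face, because a covector which is negative somewhere is negative on a
    whole nonempty face (negative_part_face).

    For the existence part, a stellar subdivision at F is realized by a
    lexicographic extension, the new element being a point just beyond F
    (stellar_subdivision_exists). The covectors of an extension are described
    by the sides of the new element that a covector meets, and the axioms
    follow from eliminations in M alone (extension_oriented_matroid). *)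

(** * Signed sets *)

(** All identities between signed sets below are checked one element at a
    time: once memberships are unfolded to atoms, only finitely many boolean
    cases remain. *)
Ltac mem_cases := rewrite /= ?inE;
  repeat match goal with |- context [?x \in ?A] => case: (x \in A) end => //=.

Lemma signed_set_eq (U : finType) (X Y : signed_set U) :
  X.1 =i Y.1 -> X.2 =i Y.2 -> X = Y.
Proof. by case: X Y => [P N] [P' N'] /= /setP-> /setP->. Qed.

Lemma signed_onP (U : finType) (S : {set U}) (X : signed_set U) :
  reflect (forall e, [/\ e \in X.1 -> e \in S, e \in X.2 -> e \in S
                       & ~~ ((e \in X.1) && (e \in X.2))])
          (signed_on S X).
Proof.
apply: (iffP and3P) => [[/subsetP s1 /subsetP s2 d] e | h].
  split; [exact: s1 | exact: s2 |].
  by apply/negP => /andP[e1 e2]; rewrite (disjointFr d e1) in e2.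
split; first by apply/subsetP => e; case: (h e).
  by apply/subsetP => e; case: (h e).
rewrite -setI_eq0; apply/eqP/setP => e; rewrite !inE.
by case: (h e) => _ _ /negbTE.
Qed.

Lemma signed_on_cases (U : finType) (S : {set U}) (X : signed_set U) :
  signed_on S X -> forall e,
  [&& (e \in X.1) ==> (e \in S), (e \in X.2) ==> (e \in S)
    & ~~ ((e \in X.1) && (e \in X.2))].
Proof. by move=> /signed_onP h e; have [s1 s2 ->] := h e; rewrite andbT; apply/andP;
  split; apply/implyP. Qed.

(** The guarantee of covector elimination away from the eliminated element.
    Since it leaves the signs on the separation set free, it is inherited when
    X or Y is replaced by the eliminated covector, so that eliminations can be
    iterated. *)
Definition off_separation (U : finType) (X Y Z : signed_set U) : Prop :=
  forall f, f \notin separation X Y ->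
    (f \in Z.1) = (f \in (sscomp X Y).1) /\
    (f \in Z.2) = (f \in (sscomp X Y).2).

(** * The covector axioms for relabelings, minors and direct sums *)

Section Relabeling.
Variables U V : finType.

Lemma relabel_oriented_matroid (f : U -> V) (M : covector_system U) :
  injective f -> oriented_matroid M -> oriented_matroid (relabel f M).
Proof.
move=> injf [hS h0 hN hC hE].
have codomE g : (exists x, g = f x) \/ forall A : {set U}, (g \in f @: A) = false.
  case: (boolP (g \in codom f)) => [/codomP | gf]; [by left | right=> A].
  by apply/negP => /imsetP[x _ gx]; rewrite gx codom_f in gf.
have comp X Y : sscomp (ssimage f X) (ssimage f Y) = ssimage f (sscomp X Y).
  by apply: signed_set_eq => g; case: (codomE g) => [[x ->] | out];
    rewrite /= !inE ?out // !(mem_imset, inE).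
have sep X Y : separation (ssimage f X) (ssimage f Y) = f @: separation X Y.
  by rewrite /separation /= imsetU !imsetI //; move=> ? ? _ _; exact: injf.
split.
- move=> _ /imsetP[X /hS /and3P[s1 s2 d] ->].
  by rewrite /signed_on /= !imsetS // imset_disjoint.
- by apply/imsetP; exists (ss0 U) => //; rewrite /ssimage /= !imset0.
- by move=> _ /imsetP[X /hN XM ->]; exact: (imset_f (ssimage f) XM).
- move=> _ _ /imsetP[X XM ->] /imsetP[Y YM ->].
  by rewrite comp; apply: imset_f; exact: hC.
move=> _ _ e /imsetP[X XM ->] /imsetP[Y YM ->].
rewrite sep => /imsetP[e0 e0s ->].
have [Z [ZM eZ hZ]] := hE _ _ _ XM YM e0s.
exists (ssimage f Z); split; first exact: imset_f.
  by rewrite /= -imsetU mem_imset.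
move=> g gs; rewrite comp /=.
case: (codomE g) => [[x gE] | out]; last by rewrite !out.
by move: gs; rewrite gE !mem_imset // => /hZ.
Qed.

Lemma unrelabel_oriented_matroid (f : U -> V) (M : covector_system V) :
  oriented_matroid M -> oriented_matroid (unrelabel f M).
Proof.
move=> [hS h0 hN hC hE].
have comp X Y : sscomp (sspreimage f X) (sspreimage f Y) =
    sspreimage f (sscomp X Y).
  by apply: signed_set_eq => e; rewrite /= !inE.
split.
- move=> _ /imsetP[X /hS /signed_onP h ->]; apply/signed_onP => e.
  by rewrite !inE; exact: h.
- by apply/imsetP; exists (ss0 V) => //; apply: signed_set_eq => e; rewrite /= !inE.
- by move=> _ /imsetP[X /hN XM ->]; exact: (imset_f (sspreimage f) XM).
- move=> _ _ /imsetP[X XM ->] /imsetP[Y YM ->].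
  by rewrite comp; apply: imset_f; exact: hC.
move=> _ _ e /imsetP[X XM ->] /imsetP[Y YM ->] es.
have [|Z [ZM eZ hZ]] := hE _ _ (f e) XM YM; first by move: es; rewrite !inE.
exists (sspreimage f Z); split; first exact: imset_f.
  by move: eZ; rewrite /= !inE.
move=> g gs; have [|h1 h2] := hZ (f g); first by move: gs; rewrite !inE.
by move: h1 h2; rewrite /= !inE.
Qed.

End Relabeling.

Section MinorsAndSums.
Variables U : finType.
Implicit Types M N : covector_system U.

Lemma restriction_oriented_matroid M (R : {set U}) :
  oriented_matroid M -> oriented_matroid (restriction M R).
Proof.
move=> [hS h0 hN hC hE].
have comp X Y : sscomp (ssrestr R X) (ssrestr R Y) = ssrestr R (sscomp X Y).
  by apply: signed_set_eq => e /=; mem_cases.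
split.
- move=> _ /imsetP[X /hS /signed_onP h ->]; apply/signed_onP => e.
  by case: (h e) => /=; mem_cases.
- by apply/imsetP; exists (ss0 U) => //; apply: signed_set_eq => e; rewrite /= !inE.
- by move=> _ /imsetP[X /hN XM ->]; exact: (imset_f (ssrestr R) XM).
- move=> _ _ /imsetP[X XM ->] /imsetP[Y YM ->].
  by rewrite comp; apply: imset_f; exact: hC.
move=> _ _ e /imsetP[X XM ->] /imsetP[Y YM ->] es.
have [|Z [ZM eZ hZ]] := hE _ _ e XM YM; first by move: es => /=; mem_cases.
exists (ssrestr R Z); split; first exact: imset_f.
  by move: eZ => /=; mem_cases.
move=> g gs; rewrite comp /=.
case gR: (g \in R); last by rewrite !inE gR !andbF.
have [|h1 h2] := hZ g; first by move: gs; rewrite /= !inE gR !andbT.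
by move: h1 h2; rewrite /= !inE gR => -> ->.
Qed.

Lemma contraction_oriented_matroid M (R : {set U}) :
  oriented_matroid M -> oriented_matroid (contraction M R).
Proof.
move=> [hS h0 hN hC hE].
have disjP (X : signed_set U) : reflect (forall e, e \in R -> (e \in X.1) = false /\
  (e \in X.2) = false)
    [disjoint X.1 :|: X.2 & R].
  apply: (iffP idP) => [d e eR | h].
    by have := disjointFl d eR; rewrite inE => /norP[/negbTE-> /negbTE->].
  rewrite -setI_eq0; apply/eqP/setP => e; rewrite !inE.
  by case eR: (e \in R); rewrite ?andbF //; have [-> ->] := h _ eR.
split.
- move=> X; rewrite inE => /andP[/hS /signed_onP h /disjP d].
  apply/signed_onP => e; have := h e; have := d e.
  by rewrite !inE; case: (e \in R) => [/(_ isT)[-> ->] []|_ []].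
- by rewrite inE h0; apply/disjP => e; rewrite !inE.
- move=> X; rewrite !inE => /andP[/hN-> /disjP d].
  by apply/disjP => e eR; have [] := d e eR.
- move=> X Y; rewrite !inE => /andP[XM /disjP dX] /andP[YM /disjP dY].
  rewrite hC //; apply/disjP => e eR; rewrite !inE.
  by have [-> ->] := dX e eR; have [-> ->] := dY e eR.
move=> X Y e; rewrite !inE => /andP[XM /disjP dX] /andP[YM /disjP dY] es.
have [|Z [ZM eZ hZ]] := hE _ _ e XM YM; first by rewrite !inE.
exists Z; split=> //; rewrite inE ZM /=.
apply/disjP => f fR; have [x1 x2] := dX f fR; have [y1 y2] := dY f fR.
by have [|-> ->] := hZ f; rewrite !inE x1 x2 // y1 y2.
Qed.

(** An element separating two covectors of the sum separates them inside one
    summand: elimination takes place there, and the other summand contributes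
    a composition. *)
Lemma direct_sum_oriented_matroid M N :
  [disjoint ground M & ground N] ->
  oriented_matroid M -> oriented_matroid N ->
  oriented_matroid (direct_sum M N).
Proof.
move=> dMN [hS h0 hN hC hE] [hS' h0' hN' hC' hE'].
have out X Y e : X \in covectors M -> Y \in covectors N ->
    [/\ ~~ ((e \in X.1) && (e \in Y.1)), ~~ ((e \in X.1) && (e \in Y.2)),
        ~~ ((e \in X.2) && (e \in Y.1)) & ~~ ((e \in X.2) && (e \in Y.2))].
  move=> /hS/signed_onP/(_ e) + /hS'/signed_onP/(_ e).
  case eM: (e \in ground M); first rewrite (disjointFr dMN eM).
    move=> [_ _ _] [].
    by case: (e \in Y.1) => [/(_ isT)|] //; case: (e \in Y.2) => [_ /(_ isT)|] //;
       rewrite !andbF.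
  move=> [].
  by case: (e \in X.1) => [/(_ isT)|] //; case: (e \in X.2) => [_ /(_ isT)|] //.
have comp X Y X' Y' : X \in covectors M -> X' \in covectors M ->
    Y \in covectors N -> Y' \in covectors N ->
    sscomp (ssunion X Y) (ssunion X' Y') =
    ssunion (sscomp X X') (sscomp Y Y').
  move=> XM XM' YN YN'.
  apply: signed_set_eq => e;
  by move: (out _ _ e XM YN) (out _ _ e XM' YN) (out _ _ e XM YN') (out _ _ e XM' YN')
    => [] + + + + [] + + + + [] + + + + [] /=; mem_cases.
have sep X Y X' Y' : X \in covectors M -> X' \in covectors M ->
    Y \in covectors N -> Y' \in covectors N ->
    separation (ssunion X Y) (ssunion X' Y') =
    separation X X' :|: separation Y Y'.
  move=> XM XM' YN YN'; apply/setP => e;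
  by move: (out _ _ e XM YN) (out _ _ e XM' YN) (out _ _ e XM YN') (out _ _ e XM' YN')
    => [] + + + + [] + + + + [] + + + + [] /=; mem_cases.
split.
- move=> _ /imset2P[X Y XM YN ->]; apply/signed_onP => e.
  move: (out _ _ e XM YN) (XM) (YN) => [] + + + + /hS/signed_onP/(_ e)[] + + +
    /hS'/signed_onP/(_ e)[].
  by rewrite /=; mem_cases; intuition.
- by apply/imset2P; exists (ss0 U) (ss0 U) => //; apply: signed_set_eq => e;
  rewrite /= !inE.
- move=> _ /imset2P[X Y /hN XM /hN' YN ->].
  exact: (imset2_f (@ssunion U) XM YN).
- move=> _ _ /imset2P[X Y XM YN ->] /imset2P[X' Y' XM' YN' ->].
  by rewrite comp //; apply: imset2_f; [exact: hC | exact: hC'].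
move=> _ _ e /imset2P[X Y XM YN ->] /imset2P[X' Y' XM' YN' ->].
rewrite sep // inE => /orP[es | es].
- have [Z [ZM eZ hZ]] := hE _ _ _ XM XM' es.
  have YY := hC' _ _ YN YN'.
  exists (ssunion Z (sscomp Y Y')); split; first exact: imset2_f.
    move: eZ es (out _ _ e XM YN) (out _ _ e XM YN') => + + [] + + + + [].
    by rewrite /=; mem_cases.
  move=> f; rewrite inE comp // => /norP[/hZ[z1 z2] _].
  by rewrite /= !(in_setU, z1, z2).
have [Z [ZN eZ hZ]] := hE' _ _ _ YN YN' es.
have XX := hC _ _ XM XM'.
exists (ssunion (sscomp X X') Z); split; first exact: imset2_f.
  move: eZ es (out _ _ e XM YN) (out _ _ e XM' YN) => + + [] + + + + [].
  by rewrite /=; mem_cases.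
move=> f; rewrite inE comp // => /norP[_ /hZ[z1 z2]].
by rewrite /= !(in_setU, z1, z2).
Qed.

End MinorsAndSums.

(** * One-element extensions *)

Section OneElementExtension.
Variables (U : finType) (M : covector_system U) (sigma : pred (signed_set U)).
Implicit Types X Y Z W : signed_set U.

Hypothesis omM : oriented_matroid M.
Hypothesis sigma0 : ~~ sigma (ss0 U).
Hypothesis sigma_total : forall X, X \in covectors M -> X != ss0 U ->
  sigma X || sigma (ssopp X).
Hypothesis sigma_elim : forall X Y Z, X \in covectors M -> Y \in covectors M ->
  Z \in covectors M -> off_separation X Y Z -> sigma X -> sigma Y -> sigma Z.

Definition conformal X Y := (X.1 \subset Y.1) && (X.2 \subset Y.2).

(** In a realization with a new hyperplane, the cell of X meets the positive
    side as soon as some face Y of the cell lies on that side, because X has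
    points arbitrarily near Y. Here [sigma] plays the role of the positive
    side and [conformal Y X] says that Y is a face of X. *)
Definition pos_side X : bool :=
  [exists Y in covectors M, conformal Y X && sigma Y].

(** The zero covector lies on every hyperplane, hence on no open side; it has
    to be allowed separately. *)
Definition nonneg_side X : bool := (X == ss0 U) || pos_side X.

Definition zero_side X : bool := nonneg_side X && nonneg_side (ssopp X).

(** A nonzero X may be extended by + if it meets the positive side, by - if it
    meets the negative one, and by 0 if it meets both; the zero covector is
    extended by 0 only. Forbidding one sign at a time, as the last two clauses
    do, gives a form of this rule that composes well. *)
Definition extension_covector (a : U) Z : bool :=
  let X := ssrestr (ground M) Z in
  [&& signed_on (a |: ground M) Z, X \in covectors M,
      (X == ss0 U) ==> (a \notin Z.1 :|: Z.2),
      (a \notin Z.2) ==> nonneg_side X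
    & (a \notin Z.1) ==> nonneg_side (ssopp X)].

Definition extension (a : U) : covector_system U :=
  CovectorSystem (a |: ground M) [set Z | extension_covector a Z].

Let signed X : X \in covectors M -> forall e,
  [/\ e \in X.1 -> e \in ground M, e \in X.2 -> e \in ground M
    & ~~ ((e \in X.1) && (e \in X.2))].
Proof. by move=> XM; apply/signed_onP; case: omM => h *; exact: h. Qed.

Lemma conformalP X Y :
  reflect (forall e, (e \in X.1 -> e \in Y.1) /\ (e \in X.2 -> e \in Y.2))
          (conformal X Y).
Proof.
apply: (iffP andP) => [[/subsetP s1 /subsetP s2] e | h].
  by split; [exact: s1 | exact: s2].
by split; apply/subsetP => e; case: (h e).
Qed.

Lemma pos_sideP X :
  reflect (exists Y, [/\ Y \in covectors M, conformal Y X & sigma Y])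
          (pos_side X).
Proof.
apply: (iffP existsP) => [[Y /and3P[]] | [Y []]] YM YX sY; exists Y => //.
exact/and3P.
Qed.

Lemma pos_side_conformal X Y : conformal X Y -> pos_side X -> pos_side Y.
Proof.
move=> /andP[s1 s2] /pos_sideP[W [WM /andP[t1 t2] sW]]; apply/pos_sideP.
exists W; split=> //; apply/andP.
by split; [exact: subset_trans s1 | exact: subset_trans s2].
Qed.

Lemma pos_side_sigma X : X \in covectors M -> sigma X -> pos_side X.
Proof. by move=> XM sX; apply/pos_sideP; exists X; split=> //; apply/andP. Qed.

Lemma ssoppK X : ssopp (ssopp X) = X. Proof. by case: X. Qed.

Lemma off_separationP X Y Z :
  off_separation X Y Z <->
  forall f, (f \notin separation X Y) ==>
    ~~ ((f \in Z.1) (+) (f \in (sscomp X Y).1)) &&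
    ~~ ((f \in Z.2) (+) (f \in (sscomp X Y).2)).
Proof.
split=> h f; first by apply/implyP => /h[-> ->]; rewrite !addbb.
move=> fs; move: (h f); rewrite fs => /andP[].
by do 4!case: (f \in _).
Qed.

Lemma signed_disjoint X : X \in covectors M ->
  forall e, ~~ ((e \in X.1) && (e \in X.2)).
Proof. by move=> XM e; case: (signed XM e). Qed.

Lemma off_separation_left X Y Z W :
  X \in covectors M -> Y \in covectors M -> Z \in covectors M ->
  off_separation X Y Z -> off_separation Z Y W -> off_separation X Y W.
Proof.
move=> /signed_disjoint dX /signed_disjoint dY /signed_disjoint dZ.
move=> /off_separationP hZ /off_separationP hW; apply/off_separationP => f.
by move: (dX f) (dY f) (dZ f) (hZ f) (hW f) => /=; mem_cases.
Qed.

Lemma off_separation_right X Y Z W :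
  X \in covectors M -> Y \in covectors M -> Z \in covectors M ->
  off_separation X Y Z -> off_separation X Z W -> off_separation X Y W.
Proof.
move=> /signed_disjoint dX /signed_disjoint dY /signed_disjoint dZ.
move=> /off_separationP hZ /off_separationP hW; apply/off_separationP => f.
by move: (dX f) (dY f) (dZ f) (hZ f) (hW f) => /=; mem_cases.
Qed.

Lemma off_separation_both X Y Z Z' W :
  X \in covectors M -> Y \in covectors M -> Z \in covectors M -> Z' \in covectors M ->
  off_separation X Y Z -> off_separation X Y Z' -> off_separation Z Z' W ->
    off_separation X Y W.
Proof.
move=> /signed_disjoint dX /signed_disjoint dY /signed_disjoint dZ /signed_disjoint dZ'.
move=> /off_separationP hZ /off_separationP hZ' /off_separationP hW;
  apply/off_separationP => f.
by move: (dX f) (dY f) (dZ f) (dZ' f) (hZ f) (hZ' f) (hW f) => /=; mem_cases.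
Qed.

Lemma separation_shrinks X Y Z e :
  X \in covectors M -> Y \in covectors M -> Z \in covectors M ->
  off_separation X Y Z -> e \notin Z.1 :|: Z.2 ->
  separation Z Y \subset separation X Y :\ e /\
  separation X Z \subset separation X Y :\ e.
Proof.
move=> /signed_disjoint dX /signed_disjoint dY /signed_disjoint dZ.
move=> /off_separationP hZ eZ; split; apply/subsetP => f; rewrite in_setD1;
case: eqP => [->|_] /=; move: eZ (dX f) (dY f) (dZ f) (hZ f); mem_cases.
Qed.

(** Between a covector meeting the positive side and one meeting the negative
    side some covector meets both, or is zero. If X and Y do not oppose each
    other, their composition does. Otherwise an elimination Z lies strictly
    between them; unless it already works, it meets one side only and replaces
    X or Y, with a smaller separation set. *)
Lemma zero_side_elimination X Y :
  X \in covectors M -> Y \in covectors M -> pos_side X ->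
  pos_side (ssopp Y) ->
  exists Z, [/\ Z \in covectors M, off_separation X Y Z & zero_side Z].
Proof.
move=> XM YM pX nY.
have [_ _ _ hC hE] := omM.
have [n] := ubnP #|separation X Y|.
elim: n => // n IHn in X Y XM YM pX nY *; rewrite ltnS => le_n.
case: (set_0Vmem (separation X Y)) => [s0 | [e es]].
  exists (sscomp X Y); split=> //; first exact: hC.
  apply/andP; split; apply/orP; right.
    by apply: pos_side_conformal pX; apply/conformalP => e; split; rewrite !inE => ->.
  apply: pos_side_conformal nY; apply/conformalP => e.
  have: e \notin separation X Y by rewrite s0 inE.
  by mem_cases.
have [Z [ZM eZ hZ]] := hE _ _ _ XM YM es.
have [sZY sXZ] := separation_shrinks XM YM ZM hZ eZ.
case Z0: (zero_side Z); first by exists Z.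
have Zn0 : Z != ss0 U by apply: contraFneq Z0 => ->;
  rewrite /zero_side /nonneg_side !eqxx.
have smaller (A : {set U}) : A \subset separation X Y :\ e -> #|A| < n.
  move=> sA; apply: leq_ltn_trans (subset_leq_card sA) _.
  by apply: leq_trans le_n; rewrite [leqRHS](cardsD1 e) es.
case/orP: (sigma_total ZM Zn0) => [/(pos_side_sigma ZM) pZ | sZ].
  have [W [WM hW zW]] := IHn _ _ ZM YM pZ nY (smaller _ sZY).
  by exists W; split=> //; exact: off_separation_left hW.
have nZ : pos_side (ssopp Z).
  by apply: pos_side_sigma => //; case: omM => _ _ hN _ _; exact: hN.
have [W [WM hW zW]] := IHn _ _ XM ZM pX nZ (smaller _ sXZ).
by exists W; split=> //; exact: off_separation_right hW.
Qed.

(** If the faces X' of X and Y' of Y lie on the positive side, then a suitable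
    face W vanishing at e does too: an elimination of X' and Y' if e separates
    them, and otherwise whichever of X', Y' vanishes at e. Composing W with an
    elimination Z of X and Y puts W back as a face. *)
Lemma pos_side_elimination X Y e :
  X \in covectors M -> Y \in covectors M -> e \in separation X Y ->
  pos_side X -> pos_side Y ->
  exists Z, [/\ Z \in covectors M, e \notin Z.1 :|: Z.2,
    off_separation X Y Z & pos_side Z].
Proof.
move=> XM YM es /pos_sideP[X' [X'M X'X sX']] /pos_sideP[Y' [Y'M Y'Y sY']].
have [_ _ _ hC hE] := omM.
have [Z [ZM eZ hZ]] := hE _ _ _ XM YM es.
suff [W [WM eW hW sW]] : exists W, [/\ W \in covectors M, e \notin W.1 :|: W.2,
    forall f, f \notin separation X Y ->
      (f \in W.1 -> f \in (sscomp X Y).1) /\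
      (f \in W.2 -> f \in (sscomp X Y).2) & sigma W].
  exists (sscomp W Z); split; first exact: hC.
  - by move: eW eZ => /=; mem_cases.
  - move=> f fs; have [z1 z2] := hZ f fs; have [w1 w2] := hW f fs.
    have dW := signed_disjoint (hC _ _ XM YM) f.
    move: w1 w2 dW z1 z2 => /implyP + /implyP.
    rewrite /= !inE => w1 w2 dW -> ->; move: w1 w2 dW.
    by mem_cases.
  - apply: (@pos_side_conformal W); last exact: pos_side_sigma.
    by apply/conformalP => f; split; rewrite !inE => ->.
have dX := signed_disjoint XM; have dY := signed_disjoint YM.
have cX := elimT (conformalP _ _) X'X; have cY := elimT (conformalP _ _) Y'Y.
case es': (e \in separation X' Y').
  have [W [WM eW hW]] := hE _ _ _ X'M Y'M es'.
  exists W; split=> //; last exact: sigma_elim sX' sY'.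
  move=> f fs; have [] := hW f.
    by move: fs (cX f) (cY f) (dX f) (dY f); mem_cases; intuition.
  by move=> -> ->; move: fs (cX f) (cY f) (dX f) (dY f); mem_cases; intuition.
case eY': (e \in Y'.1 :|: Y'.2).
  case eX': (e \in X'.1 :|: X'.2).
    by exfalso; move: es es' eX' eY' (cX e) (cY e) (dX e) (dY e); mem_cases; intuition.
  exists X'; split=> //; first by rewrite eX'.
  by move=> f fs; move: fs (cX f) (cY f) (dX f) (dY f); mem_cases; intuition.
exists Y'; split=> //; first by rewrite eY'.
by move=> f fs; move: fs (cX f) (cY f) (dX f) (dY f); mem_cases; intuition.
Qed.

Lemma off_separation_opp X Y Z :
  off_separation (ssopp X) (ssopp Y) Z -> off_separation X Y (ssopp Z).
Proof.
move=> h f fs; have [|h1 h2] := h f; last by split.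
by move: fs => /=; mem_cases.
Qed.

Lemma ssopp_eq0 X : (ssopp X == ss0 U) = (X == ss0 U).
Proof. by apply/eqP/eqP => [/(congr1 (@ssopp U))|->] //; rewrite ssoppK. Qed.

Lemma pos_side_neq0 X : pos_side X -> X != ss0 U.
Proof.
move=> /pos_sideP[Y [_ /conformalP YX sY]]; apply: contraNneq sigma0 => X0.
suff <- : Y = ss0 U by [].
by apply: signed_set_eq => e; move: (YX e); rewrite X0 => -[/implyP + /implyP];
  mem_cases.
Qed.

Lemma sscomp_eq0 X Y :
  (sscomp X Y == ss0 U) = (X == ss0 U) && (Y == ss0 U).
Proof.
apply/eqP/andP => [XY0 | [/eqP-> /eqP->]]; last first.
  by apply: signed_set_eq => e; rewrite !inE.
have h e : (e \in (sscomp X Y).1) = false /\ (e \in (sscomp X Y).2) = false.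
  by rewrite XY0 !inE.
split; apply/eqP; apply: signed_set_eq => e; move: (h e) => []; mem_cases.
Qed.

Lemma ss0_comp X : sscomp (ss0 U) X = X.
Proof. by apply: signed_set_eq => e; rewrite !inE. Qed.

Lemma conformal_comp X Y : conformal X (sscomp X Y).
Proof. by apply/conformalP => f; split; rewrite !inE => ->. Qed.

Lemma side_exists X : X \in covectors M -> X != ss0 U ->
  pos_side X || pos_side (ssopp X).
Proof.
have [_ _ hN _ _] := omM => XM /(sigma_total XM).
by case/orP=> /pos_side_sigma -> //; rewrite ?orbT //; exact: hN.
Qed.

Section NewElement.
Variable a : U.
Hypothesis aM : a \notin ground M.

Definition lift (z : bool * bool) X : signed_set U :=
  ((if z.1 then a |: X.1 else X.1), (if z.2 then a |: X.2 else X.2)).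

Lemma lift_in1 z X e : X \in covectors M ->
  (e \in (lift z X).1) = if e == a then z.1 else e \in X.1.
Proof.
move=> XM; have [s1 _ _] := signed XM e; rewrite /lift /=.
case: z.1; rewrite ?in_setU1; case: eqP => //= ea.
by apply/negbTE; apply: contra aM; rewrite -ea.
Qed.

Lemma lift_in2 z X e : X \in covectors M ->
  (e \in (lift z X).2) = if e == a then z.2 else e \in X.2.
Proof.
move=> XM; have [_ s2 _] := signed XM e; rewrite /lift /=.
case: z.2; rewrite ?in_setU1; case: eqP => //= ea.
by apply/negbTE; apply: contra aM; rewrite -ea.
Qed.

Lemma lift_restr z X : X \in covectors M -> ssrestr (ground M) (lift z X) = X.
Proof.
move=> XM; apply: signed_set_eq => e; have [s1 s2 _] := signed XM e;
rewrite in_setI ?lift_in1 ?lift_in2 //;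
(case: eqP => [->|_]; last exact: andb_idr);
by rewrite (negbTE aM) andbF; apply/esym/negbTE; apply: contra aM;
  have [] := signed XM a.
Qed.

Lemma lift_extension z X :
  X \in covectors M -> ~~ (z.1 && z.2) ->
  (X == ss0 U -> ~~ z.1 && ~~ z.2) ->
  (~~ z.2 -> nonneg_side X) -> (~~ z.1 -> nonneg_side (ssopp X)) ->
  lift z X \in covectors (extension a).
Proof.
move=> XM zd z0 zp zn.
rewrite inE /extension_covector lift_restr // in_setU negb_or.
rewrite lift_in1 // lift_in2 // eqxx XM.
apply/and5P; split=> //; try exact/implyP.
apply/signed_onP => e; rewrite lift_in1 // lift_in2 // in_setU1.
by case: eqP => //= _; exact: signed.
Qed.

(** The only delicate axiom is elimination. At the new element it is
    zero_side_elimination. At an old element e the sign at the new element is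
    prescribed unless it is itself separated: a prescribed + or - comes from
    pos_side_elimination, and a prescribed 0 from eliminating the new element
    between the two covectors so obtained, both of which vanish at e. *)
Lemma extension_oriented_matroid : oriented_matroid (extension a).
Proof.
have [hS h0 hN hC hE] := omM.
have restr_comp X Y : ssrestr (ground M) (sscomp X Y) =
    sscomp (ssrestr (ground M) X) (ssrestr (ground M) Y).
  by apply: signed_set_eq => e /=; mem_cases.
have extP Z : Z \in covectors (extension a) ->
  [/\ signed_on (a |: ground M) Z, ssrestr (ground M) Z \in covectors M,
      ssrestr (ground M) Z == ss0 U -> (a \in Z.1) || (a \in Z.2) = false,
      a \notin Z.2 -> nonneg_side (ssrestr (ground M) Z)
    & a \notin Z.1 -> nonneg_side (ssopp (ssrestr (ground M) Z))].
  rewrite inE => /and5P[h1 h2 /implyP hz /implyP hp /implyP hn]; split=> //.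
  by move=> /hz; rewrite inE => /negbTE.
split.
- by move=> Z; rewrite inE => /and5P[].
- have -> : ss0 U = lift (false, false) (ss0 U) by [].
  by apply: lift_extension => // _; rewrite /nonneg_side eqxx.
- move=> Z /extP[/signed_onP sZ ZM hz hp hn].
  rewrite inE; apply/and5P; split; last 4 first.
  + exact: (hN _ ZM).
  + by rewrite (ssopp_eq0 (ssrestr _ _)) setUC inE; apply/implyP => /hz ->.
  + exact/implyP.
  + exact/implyP.
  by apply/signed_onP => e; have [? ? d] := sZ e; split=> //; rewrite andbC.
- move=> X Y /extP[/signed_onP sX XM zX pX nX] /extP[/signed_onP sY YM zY pY nY].
  rewrite inE; apply/and5P; rewrite restr_comp; split; last 4 first.
  + exact: hC.
  + rewrite sscomp_eq0; apply/implyP => /andP[/zX + /zY]; mem_cases.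
  + apply/implyP => aXY; have aX : a \notin X.2 by move: aXY; mem_cases.
    have := pX aX; case/orP=> [X0 | pX'].
      rewrite (eqP X0) ss0_comp; apply: pY.
      by move: (zX X0) aXY; mem_cases.
    by apply/orP; right; apply: pos_side_conformal pX'; exact: conformal_comp.
  + apply/implyP => aXY; have aX : a \notin X.1 by move: aXY; mem_cases.
    have := nX aX; case/orP=> [X0 | nX'].
      rewrite ssopp_eq0 in X0; rewrite (eqP X0) ss0_comp; apply: nY.
      by move: (zX X0) aXY; mem_cases.
    apply/orP; right; apply: pos_side_conformal nX'.
    exact: (conformal_comp (ssopp (ssrestr _ X)) (ssopp (ssrestr _ Y))).
  apply/signed_onP => e; move: (sX e) (sY e) => [+ + dX] [+ + dY].
  by move: dX dY; mem_cases; rewrite ?orbT /=; intuition.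
move=> X Y e XE YE es.
have [/signed_on_cases sX XM zX pX nX] := extP _ XE.
have [/signed_on_cases sY YM zY pY nY] := extP _ YE.
set X' := ssrestr (ground M) X in XM zX pX nX.
set Y' := ssrestr (ground M) Y in YM zY pY nY.
have sepE f : f != a -> (f \in separation X' Y') = (f \in separation X Y).
  by move=> fa; move: (sX f) (sY f); rewrite in_setU1 (negbTE fa); mem_cases.
have compE1 f : f != a -> (f \in (sscomp X' Y').1) = (f \in (sscomp X Y).1).
  by move=> fa; move: (sX f) (sY f); rewrite in_setU1 (negbTE fa); mem_cases.
have compE2 f : f != a -> (f \in (sscomp X' Y').2) = (f \in (sscomp X Y).2).
  by move=> fa; move: (sX f) (sY f); rewrite in_setU1 (negbTE fa); mem_cases.
suff [W [z [WM offW [zd z0 zp zn] [eW za]]]] : exists W z,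
  [/\ W \in covectors M, off_separation X' Y' W,
    [/\ ~~ (z.1 && z.2), W == ss0 U -> ~~ z.1 && ~~ z.2,
    ~~ z.2 -> nonneg_side W & ~~ z.1 -> nonneg_side (ssopp W)]
  & (if e == a then ~~ z.1 && ~~ z.2 else e \notin W.1 :|: W.2) /\
    (a \notin separation X Y -> z.1 = (a \in (sscomp X Y).1) /\
       z.2 = (a \in (sscomp X Y).2))].
  exists (lift z W); split; first exact: lift_extension.
    by rewrite inE lift_in1 // lift_in2 //; move: eW; case: eqP; rewrite ?inE ?negb_or.
  move=> f fs; rewrite lift_in1 // lift_in2 //.
  case: (eqVneq f a) => [fa | fa]; first by rewrite fa in fs *; exact: za.
  by rewrite -compE1 // -compE2 //; apply: offW; rewrite sepE.
case: (eqVneq e a) => [ea | ea].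
  suff [W [WM offW /andP[pW nW]]] : exists Z,
      [/\ Z \in covectors M, off_separation X' Y' Z & zero_side Z].
    by exists W, (false, false); split=> //; split=> //; rewrite -ea es.
  have X'n0 : X' != ss0 U by apply/negP => /zX; move: es; rewrite ea; mem_cases.
  have Y'n0 : Y' != ss0 U by apply/negP => /zY; move: es; rewrite ea; mem_cases.
  move: pX nX pY nY; rewrite /nonneg_side !ssopp_eq0 (negbTE X'n0) (negbTE Y'n0) /=.
  move=> pX nX pY nY.
  move: es (sX a) (sY a); rewrite ea !inE.
  move=> /orP[] /andP[aX aY] /and3P[_ _ dX] /and3P[_ _ dY].
    rewrite aX in dX; rewrite aY andbT in dY.
    by apply: zero_side_elimination => //; [apply: pX | apply: nY].
  rewrite aX andbT in dX; rewrite aY in dY.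
  have [|||| Z [ZM offZ /andP[pZ nZ]]] := @zero_side_elimination (ssopp X') (ssopp Y').
  - exact: hN.
  - exact: hN.
  - exact: nX.
  - by rewrite ssoppK; exact: pY.
  exists (ssopp Z); split; [exact: hN | exact: off_separation_opp |].
  by rewrite /zero_side ssoppK nZ.
have es' : e \in separation X' Y' by rewrite sepE.
have X'n0 : X' != ss0 U by apply/negP => /eqP X0; move: es'; rewrite X0; mem_cases.
have Y'n0 : Y' != ss0 U by apply/negP => /eqP Y0; move: es'; rewrite Y0; mem_cases.
case as_ : (a \in separation X Y).
  have [W [WM eW offW]] := hE _ _ _ XM YM es'.
  have [W0 | Wn0] := eqVneq W (ss0 U).
    exists W, (false, false); split=> //.
    by split=> //= _; rewrite /nonneg_side ?ssopp_eq0 W0 eqxx.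
  have [pW | nW] := orP (side_exists WM Wn0).
    exists W, (true, false); split=> //.
    by split=> //=; rewrite ?(negbTE Wn0) // /nonneg_side pW orbT.
  exists W, (false, true); split=> //.
  by split=> //=; rewrite ?(negbTE Wn0) // /nonneg_side nW orbT.
move: pX nX pY nY; rewrite /nonneg_side !ssopp_eq0 (negbTE X'n0) (negbTE Y'n0) !orFb.
move=> pX nX pY nY.
have posW : a \notin (sscomp X Y).2 -> exists Z,
    [/\ Z \in covectors M, e \notin Z.1 :|: Z.2, off_separation X' Y' Z & pos_side Z].
  move=> aXY; apply: pos_side_elimination => //.
    by apply: pX; move: aXY; mem_cases.
  by apply: pY; move: as_ aXY (sX a); mem_cases.
have negW : a \notin (sscomp X Y).1 -> exists Z,
    [/\ Z \in covectors M, e \notin Z.1 :|: Z.2, off_separation X' Y' Z & pos_side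
      (ssopp Z)].
  move=> aXY.
  have es'' : e \in separation (ssopp X') (ssopp Y').
    by move: es' => /=; mem_cases.
  have [||Z [ZM eZ offZ pZ]] := pos_side_elimination (hN _ XM) (hN _ YM) es''.
  - by apply: nX; move: aXY; mem_cases.
  - by apply: nY; move: as_ aXY (sX a); mem_cases.
  exists (ssopp Z); rewrite ssoppK; split;
    [exact: hN | | exact: off_separation_opp | by []].
  by move: eZ => /=; mem_cases.
have dXY : ~~ ((a \in (sscomp X Y).1) && (a \in (sscomp X Y).2)).
  by move: (sX a) (sY a); rewrite setU11; mem_cases.
case a1 : (a \in (sscomp X Y).1).
  rewrite a1 andTb in dXY; have [W [WM eW offW pW]] := posW dXY.
  exists W, (true, false); split=> //.
    by split=> //= [|_]; rewrite /nonneg_side ?pW ?orbT // (negbTE (pos_side_neq0 pW)).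
  by split=> // _; rewrite (negbTE dXY).
case a2 : (a \in (sscomp X Y).2).
  have [W [WM eW offW pW]] := negW (negbT a1).
  exists W, (false, true); split=> //.
  split=> //= [|_]; rewrite /nonneg_side ?pW ?orbT //.
  by rewrite -ssopp_eq0 (negbTE (pos_side_neq0 pW)).
have [P [PM eP offP pP]] := posW (negbT a2).
have [N [NM eN offN pN]] := negW (negbT a1).
have [Z [ZM offZ /andP[pZ nZ]]] := zero_side_elimination PM NM pP pN.
exists Z, (false, false); split=> //.
  exact: (off_separation_both XM YM PM NM offP offN offZ).
split=> //.
have [|] := offZ e; first by move: eP; mem_cases.
by rewrite in_setU => -> ->; move: eP eN => /=; mem_cases.
Qed.

End NewElement.

End OneElementExtension.

(** * Lexicographic sides *)

Section LexicographicSide.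
Variable U : finType.
Implicit Types (X Y Z : signed_set U) (l : seq (U * bool)) (s : seq U) (P : {set U}).

(** The sign of X at the point e_1 + eps e_2 + eps^2 e_3 + ..., for an
    infinitesimal eps, where a list entry (e, false) stands for - e: the first
    nonzero sign decides. *)
Fixpoint lexpos l X : bool :=
  if l is (e, b) :: l' then
    if e \in (if b then X.1 else X.2) then true
    else if e \in (if b then X.2 else X.1) then false
    else lexpos l' X
  else false.

Lemma lexpos0 l : ~~ lexpos l (ss0 U).
Proof. by elim: l => //= -[e []] l; rewrite !inE. Qed.

Lemma lexpos_total S l X : signed_on S X ->
  (forall e, e \in S -> e \in unzip1 l) -> X != ss0 U ->
  lexpos l X || lexpos l (ssopp X).
Proof.
move=> /signed_onP sX Sl; apply: contraR; rewrite negb_or => /andP[n1 n2].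
have h e : e \in unzip1 l -> (e \notin X.1) && (e \notin X.2).
  elim: l n1 n2 {Sl} => //= -[f b] l IHl n1 n2; rewrite in_cons.
  move: n1 n2; case: b => /=; case f1: (f \in X.1) => //=;
    case f2: (f \in X.2) => //= n1 n2 /orP[/eqP->|]; rewrite ?f1 ?f2 //;
    exact: IHl.
apply/eqP; apply: signed_set_eq => e; rewrite !inE; apply/negbTE; apply/negP => eX;
  have [s1 s2 _] := sX e.
  by have := h e (Sl _ (s1 eX)); rewrite eX.
by have := h e (Sl _ (s2 eX)); rewrite eX andbF.
Qed.

Lemma lexpos_off_separation S l X Y Z :
  signed_on S X -> signed_on S Y -> signed_on S Z ->
  off_separation X Y Z -> lexpos l X -> lexpos l Y -> lexpos l Z.
Proof.
move=> /signed_on_cases sX /signed_on_cases sY /signed_on_cases sZ.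
move=> /off_separationP hZ; elim: l => //= -[e b] l IHl.
move: (sX e) (sY e) (sZ e) (hZ e) IHl.
by case: b; mem_cases => _ _ _ _; exact.
Qed.

Lemma lexpos_true_cat s l P :
  (lexpos ([seq (e, true) | e <- s] ++ l) (P, set0) =
     has (mem P) s || lexpos l (P, set0)) *
  (lexpos ([seq (e, true) | e <- s] ++ l) (set0, P) =
     ~~ has (mem P) s && lexpos l (set0, P)).
Proof.
split; elim: s => //= e s ->; rewrite inE; by case: (e \in P).
Qed.

Lemma lexpos_false s P :
  (lexpos [seq (e, false) | e <- s] (P, set0) = false) *
  (lexpos [seq (e, false) | e <- s] (set0, P) = has (mem P) s).
Proof.
split; elim: s => //= e s ->; rewrite inE; by case: (e \in P).
Qed.

(** The new point: a point in the relative interior of F, pushed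
    infinitesimally away from the remaining elements, that is, just beyond the
    face F. *)
Definition lexicographic (F S : {set U}) :=
  lexpos ([seq (e, true) | e <- enum F] ++ [seq (e, false) | e <- enum (S :\: F)]).

Lemma has_enum (A P : {set U}) : has (mem P) (enum A) = ~~ [disjoint A & P].
Proof.
apply/hasP/pred0Pn => [[e eA eP] | [e /andP[eA eP]]]; exists e.
  by apply/andP; rewrite mem_enum in eA.
  by rewrite mem_enum.
by [].
Qed.

Lemma lexicographic_nonneg (F S : {set U}) (P : {set U}) :
  (lexicographic F S (P, set0) = ~~ [disjoint F & P]) *
  (lexicographic F S (set0, P) = [disjoint F & P] && ~~ [disjoint S :\: F & P]).
Proof.
by split; rewrite /lexicographic lexpos_true_cat lexpos_false !has_enum ?orbF ?negbK.
Qed.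

End LexicographicSide.

(** * Faces *)

Section Faces.
Variables (U : finType) (M : covector_system U).
Hypothesis omM : oriented_matroid M.
Implicit Types (F G H P : {set U}).

Lemma facesP G : reflect (G \subset ground M /\ (ground M :\: G, set0) \in covectors M)
  (G \in faces M).
Proof. by rewrite inE; exact: andP. Qed.

Lemma face_of_covector P : (P, set0) \in covectors M -> ground M :\: P \in faces M.
Proof.
move=> PM; apply/facesP; split; first exact: subsetDl.
have [hS _ _ _ _] := omM; have /and3P[/= PS _ _] := hS _ PM.
by rewrite setDDr setDv set0U (setIidPr PS).
Qed.

Lemma ground_face : ground M \in faces M.
Proof. by have [_ + _ _ _] := omM => /face_of_covector; rewrite setD0. Qed.

(** Nonnegative covectors compose, and their zero sets intersect. *)
Lemma faces_setI F G : F \in faces M -> G \in faces M -> F :&: G \in faces M.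
Proof.
move=> /facesP[FS FM] /facesP[GS GM]; apply/facesP; split.
  exact: subset_trans (subsetIl _ _) FS.
have [_ _ _ hC _] := omM; have := hC _ _ FM GM.
by rewrite /sscomp /= setD0 set0D setU0 setDIr.
Qed.

Lemma proper_facesP G :
  reflect (G \in faces M /\ G <> ground M) (G \in proper_faces M).
Proof.
rewrite /proper_faces in_setD1 andbC.
by apply: (iffP andP) => -[GM /eqP].
Qed.

Lemma acyclic_set0 : acyclic M <-> set0 \in faces M.
Proof. by rewrite inE sub0set setD0. Qed.

End Faces.

(** * Existence of stellar subdivisions *)

Section Stellar.
Variables (U : finType) (M : covector_system U) (F : {set U}) (a : U).
Hypothesis omM : oriented_matroid M.
Hypothesis acM : acyclic M.
Hypothesis Fproper : F \in proper_faces M.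
Hypothesis Fn0 : F != set0.
Hypothesis aM : a \notin ground M.
Implicit Types (G H P : {set U}).

Let S := ground M.
Let sigma := lexicographic F S.
Let N := extension M sigma a.
Let FS : F \subset S.
Proof. by have /proper_facesP[/facesP[]] := Fproper. Qed.

Lemma stellar_extension_oriented_matroid : oriented_matroid N.
Proof.
have [hS _ _ _ _] := omM.
apply: extension_oriented_matroid => //.
- exact: lexpos0.
- move=> X XM Xn0; apply: lexpos_total (hS _ XM) _ Xn0 => e eS.
  rewrite /unzip1 map_cat mem_cat -!map_comp !map_id !mem_enum in_setD eS.
  by case: (e \in F).
- move=> X Y Z /hS sX /hS sY /hS sZ; exact: lexpos_off_separation sX sY sZ.
Qed.

(** The new point is infinitely near to the interior of F, so a nonnegative
    covector is positive there unless it vanishes on F. *)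
Lemma pos_side_nonneg P : (P, set0) \in covectors M ->
  pos_side M sigma (P, set0) = ~~ [disjoint F & P].
Proof.
move=> PM; apply/pos_sideP/idP => [[[Q Q'] [QM /andP[/= QP]]] | FP].
  rewrite subset0 => /eqP->; rewrite /sigma lexicographic_nonneg.
  by apply: contra; apply: disjointWr.
by exists (P, set0); split=> //; [exact/andP | rewrite /sigma lexicographic_nonneg].
Qed.

(** The proper faces from which the point just beyond F is visible are those
    that contain F. *)
Lemma pos_side_nonpos G : G \in faces M ->
  pos_side M sigma (set0, S :\: G) = [exists H in proper_faces M, F :|: G \subset H].
Proof.
have [hS _ hN _ _] := omM.
move=> /facesP[GS GM].
apply/pos_sideP/existsP => [[[Q' Q] [QM /andP[/= + QP]]] | [H /andP[Hp]]].
  rewrite subset0 => /eqP Q'0; rewrite {}Q'0 in QM *.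
  rewrite /sigma lexicographic_nonneg => /andP[FQ SQ].
  have QS : Q \subset S by have /and3P[] := hS _ QM.
  exists (S :\: Q); apply/andP; split.
    apply/proper_facesP; split; first exact: face_of_covector (hN _ QM).
    move=> /setP SQS; case/pred0Pn: SQ => e /= /andP[+ eQ].
    rewrite in_setD => /andP[_ eS].
    by have := SQS e; rewrite in_setD eQ eS.
  apply/subsetP => e; rewrite in_setU in_setD => /orP[eF | eG].
    by rewrite (subsetP FS _ eF) (disjointFr FQ eF).
  rewrite (subsetP GS _ eG) andbT; apply: contraL eG => eQ.
  by have := subsetP QP e eQ; rewrite in_setD => /andP[].
rewrite subUset => /andP[FH GH].
have /proper_facesP[/facesP[HS HM] Hn] := Hp.
exists (set0, S :\: H); split; first exact: (hN _ HM).
  by rewrite /conformal sub0set setDS.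
rewrite /sigma lexicographic_nonneg; apply/andP; split.
  rewrite disjoints_subset; apply/subsetP => e /(subsetP FH) eH.
  by rewrite in_setC in_setD eH.
have /subsetPn[e eS eH] : ~~ (S \subset H).
  by apply: contra_notN Hn => SH; apply/eqP; rewrite eqEsubset HS.
apply/pred0Pn; exists e; rewrite /= !in_setD eS eH !andbT.
by apply: contra eH; exact: (subsetP FH).
Qed.

(** A set without the new element is a face when its covector is positive at
    the new point, which fails exactly for the sets containing F. A set with
    the new element is a face when its covector vanishes there, so this
    covector is zero or meets both sides. *)
Lemma stellar_extension_faces G' : G' \in faces N =
  [&& G' \subset a |: S, G' :&: S \in faces M &
    if a \in G' then (G' :&: S == S) ||
       ~~ (F \subset G') && [exists H in proper_faces M, F :|: (G' :&: S) \subset H]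
    else ~~ (F \subset G')].
Proof.
rewrite inE [ground N]/=; case G'S: (G' \subset a |: S) => //=.
have restrE : ssrestr S ((a |: S) :\: G', set0) = (S :\: (G' :&: S), set0).
  apply: signed_set_eq => e; rewrite /= !inE //.
  by case: (eqVneq e a) => [->|_] /=; rewrite ?(negbTE aM) ?andbF //; case: (e \in S);
    rewrite ?andbT ?andbF.
rewrite [LHS]inE /extension_covector restrE.
have -> : signed_on (a |: S) ((a |: S) :\: G', set0).
  by apply/signed_onP => e; rewrite !inE andbF; split=> // /andP[].
have FG : (F \subset G') = (F \subset G' :&: S) by rewrite subsetI FS andbT.
rewrite [_ \in faces M]inE subsetIr /=.
case GM: (_ \in covectors M) => //=.
have GF : G' :&: S \in faces M by rewrite inE subsetIr.
have X0 : ((S :\: (G' :&: S), set0) == ss0 U) = (G' :&: S == S).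
  by rewrite xpair_eqE eqxx andbT setD_eq0 eqEsubset subsetIr.
have disjE : [disjoint F & S :\: (G' :&: S)] = (F \subset G').
  rewrite disjoints_subset FG setCD; apply/subsetP/subsetP => h e eF; have := h e eF;
    rewrite !inE (subsetP FS _ eF) //= ?andbT //.
rewrite /nonneg_side ssopp_eq0 X0 [ssopp _]/= pos_side_nonneg // pos_side_nonpos //
  disjE.
rewrite !in_set0 /= setU0 in_setD setU11 andbT negbK.
case: (eqVneq (G' :&: S) S) => [GS | _] /=.
  have FG' : F \subset G' by rewrite FG GS.
  by rewrite FG'; case: ifP.
by case: ifP => _; rewrite ?andbT.
Qed.

Theorem stellar_subdivision_exists : exists N, is_stellar_subdivision a F M N.
Proof.
exists N; split; first by split.
have acN : acyclic N.
  apply/acyclic_set0; rewrite stellar_extension_faces sub0set set0I in_set0 subset0 Fn0.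
  by rewrite (acyclic_set0 M).1.
split=> //; first exact: stellar_extension_oriented_matroid.
have dropa G : a \in G -> G \subset a |: S -> G = a |: (G :&: S).
  move=> aG /subsetP GS; apply/setP => e; have := GS e; rewrite !inE.
  case: (eqVneq e a) => [->|_] /=; first by rewrite aG.
  by case: (e \in G) => // ->.
have aout G : G \subset S -> (a |: G) :&: S = G.
  move=> /subsetP GS; apply/setP => e; have := GS e; rewrite !inE.
  case: (eqVneq e a) => [->|_] /=; first by rewrite (negbTE aM);
    case: (a \in G) => // /(_ isT).
  by case: (e \in G) => // ->.
apply/setP => G'; rewrite in_setD1 stellar_extension_faces in_setU.
apply/andP/orP => [[G'n /and3P[G'S GM]] | [|/imsetP[G]]].
- case aG': (a \in G').
    rewrite {1}(dropa _ aG' G'S) in G'n.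
    have Gn : G' :&: S != S by apply: contraNneq G'n => ->.
    rewrite (negbTE Gn) /= => /andP[FG' ex]; right; apply/imsetP; exists (G' :&: S);
      last exact: dropa.
    rewrite inE ex andbT; apply/andP; split; first by apply/proper_facesP; split=> //;
      exact/eqP.
    by apply: contra FG' => /subset_trans; apply; exact: subsetIl.
  have G'E : G' :&: S = G'.
    apply/setIidPl/subsetP => e eG'; have := subsetP G'S e eG'.
    by rewrite in_setU1 => /orP[/eqP ea|//]; rewrite ea aG' in eG'.
  rewrite G'E in GM; move=> FG'; left; rewrite inE FG' andbT; apply/proper_facesP.
  split=> // GE; by rewrite GE FS in FG'.
- rewrite inE => /andP[/proper_facesP[G'M G'n] FG'].
  have /facesP[G'S _] := G'M.
  have aG' : (a \in G') = false by apply/negbTE; apply: contra aM; exact: (subsetP G'S).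
  rewrite aG' FG' (setIidPl G'S) G'M (subset_trans G'S (subsetUr _ _)); split=> //.
  by apply/eqP => E; rewrite E setU11 in aG'.
rewrite inE => /andP[Gp /andP[FG ex]] ->.
have /proper_facesP[GM /eqP Gn] := Gp; have /facesP[GS _] := GM.
rewrite aout // setU11 GM setUS // (negbTE Gn) ex /= andbT.
split; last by apply: contra FG => FaG; rewrite -(aout G) // subsetI FaG.
by apply: contraNneq Gn => E; rewrite -(aout G) // [a |: G]E aout.
Qed.

End Stellar.

(** * Faces of relabelings, minors and sums *)

Lemma preimset_imset (U V : finType) (f : U -> V) (A : {set U}) :
  injective f -> f @^-1: (f @: A) = A.
Proof. by move=> injf; apply/setP => e; rewrite inE mem_imset. Qed.

Lemma subset_imset_inj (U V : finType) (f : U -> V) (A B : {set U}) :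
  injective f -> (f @: A \subset f @: B) = (A \subset B).
Proof. by move=> injf; rewrite sub_imset_pre preimset_imset. Qed.

Section FacesOfRelabelings.
Variables U V : finType.

Lemma faces_relabel (f : U -> V) (M : covector_system U) (G : {set V}) :
  injective f ->
  (G \in faces (relabel f M)) = (G \subset f @: ground M) && (f @^-1: G \in faces M).
Proof.
move=> injf; rewrite inE /=; case GS: (G \subset _) => //=.
have preS : f @^-1: G \subset ground M.
  by apply/subsetP => e; rewrite inE => /(subsetP GS); rewrite mem_imset.
rewrite inE preS /=; apply/imsetP/idP => [[X XM [X1 X2]] | XM].
  suff -> : (ground M :\: f @^-1: G, set0) = X by [].
  apply: signed_set_eq => e; rewrite -[in RHS](mem_imset _ _ injf).
    by rewrite -X1 !inE mem_imset.
  by rewrite -X2 !inE.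
exists (ground M :\: f @^-1: G, set0) => //.
rewrite /ssimage /= imset0; congr (_, _); apply/setP => g; rewrite inE.
apply/andP/imsetP => [[gG /imsetP[e eS gE]] | [e + ->]].
  by exists e => //; rewrite !inE -gE gG.
by rewrite !inE mem_imset // => /andP[].
Qed.

Lemma faces_unrelabel (f : U -> V) (M : covector_system V) (G : {set U}) :
  oriented_matroid M -> injective f -> ground M \subset codom f ->
  (G \in faces (unrelabel f M)) = (f @: G \in faces M).
Proof.
move=> [hS _ _ _ _] injf cod; rewrite [LHS]inE /= [RHS]inE.
have -> : (G \subset f @^-1: ground M) = (f @: G \subset ground M).
  by rewrite sub_imset_pre.
case GS: (f @: G \subset ground M) => //=; apply/imsetP/idP => [[X XM [X1 X2]] | XM].
  suff -> : (ground M :\: f @: G, set0) = X by [].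
  have /signed_onP sX := hS _ XM.
  apply: signed_set_eq => g; have [s1 s2 _] := sX g.
    case: (boolP (g \in ground M)) => gM; last first.
      by rewrite !inE (negbTE gM) andbF; apply/esym; apply: contraNF gM.
    have /codomP[e gE] := subsetP cod g gM.
    rewrite gE /= in_setD mem_imset //; move/setP/(_ e): X1.
    by rewrite !inE => ->.
  rewrite inE; apply/esym/negbTE/negP => gX.
  have /codomP[e gE] := subsetP cod g (s2 gX).
  by move/setP/(_ e): X2; rewrite !inE -gE gX.
exists (ground M :\: f @: G, set0) => //.
by apply: signed_set_eq => e; rewrite /= !inE // mem_imset.
Qed.

End FacesOfRelabelings.

Section FacesOfMinorsAndSums.
Variables (U : finType).
Implicit Types (M N : covector_system U) (F G H R : {set U}).

Lemma faces_direct_sum M N G :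
  oriented_matroid M -> oriented_matroid N -> [disjoint ground M & ground N] ->
  (G \in faces (direct_sum M N)) =
  [&& G \subset ground M :|: ground N, G :&: ground M \in faces M
    & G :&: ground N \in faces N].
Proof.
move=> [hM _ _ _ _] [hN _ _ _ _] dMN; rewrite inE /=.
case GS: (G \subset _) => //=; rewrite !inE !subsetIr /=.
rewrite !setDIr !setDv !setU0.
apply/imset2P/andP => [[X Y XM YN [E1 E2]] | [XM YN]].
  have /signed_onP sX := hM _ XM; have /signed_onP sY := hN _ YN.
  split.
    suff -> : (ground M :\: G, set0) = X by [].
    apply: signed_set_eq => e; have [x1 x2 _] := sX e; have [y1 y2 _] := sY e.
      move/setP/(_ e): E1; rewrite !inE.
      case eM: (e \in ground M); last first.
        by move=> _; rewrite andbF; apply/esym; apply: contraFF eM.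
      have -> : (e \in Y.1) = false.
        by apply/negbTE/negP => /y1; rewrite (disjointFr dMN eM).
      by rewrite orbF.
    move/setP/(_ e): E2; rewrite !inE => /esym/negbT/norP[+ _].
    by move=> /negbTE->.
  suff -> : (ground N :\: G, set0) = Y by [].
  apply: signed_set_eq => e; have [x1 x2 _] := sX e; have [y1 y2 _] := sY e.
    move/setP/(_ e): E1; rewrite !inE.
    case eN: (e \in ground N); last first.
      by move=> _; rewrite andbF; apply/esym; apply: contraFF eN.
    have -> : (e \in X.1) = false.
      by apply/negbTE/negP => /x1; rewrite (disjointFl dMN eN).
    by rewrite orbT.
  move/setP/(_ e): E2; rewrite !inE => /esym/negbT/norP[_].
  by move=> /negbTE->.
exists (ground M :\: G, set0) (ground N :\: G, set0) => //.
by rewrite /ssunion /= setDUl setU0.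
Qed.

(** Composing with the nonnegative covector that vanishes exactly on F extends
    any covector of the restriction that is nonnegative on F to one that is
    nonnegative everywhere. *)
Lemma faces_restriction M F : oriented_matroid M -> F \in faces M ->
  faces (restriction M F) = below (faces M) F.
Proof.
move=> [hS h0 hN hC hE] /facesP[FS FM]; apply/setP => G; rewrite [RHS]inE !inE /=.
rewrite (setIidPr FS); case GF: (G \subset F); rewrite /= ?andbF // andbT.
rewrite (subset_trans GF FS) /=; apply/imsetP/idP => [[X XM [E1 E2]] | GM].
  have /signed_onP sX := hS _ XM.
  suff -> : (ground M :\: G, set0) = sscomp (ground M :\: F, set0) X by exact: hC.
  apply: signed_set_eq => e; have [s1 s2 _] := sX e;
    move/setP/(_ e): E1; move/setP/(_ e): E2; rewrite !inE.
    case: (boolP (e \in F)) => eF /=;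
      first by rewrite !andbT (subsetP FS _ eF) andbT => _ ->.
    case: (boolP (e \in ground M)) => eM; rewrite ?andbF ?andbT //=.
      by move=> _ _; apply/negP => /(subsetP GF); rewrite (negbTE eF).
    by move=> _ _; apply/esym; apply: contraNF eM.
  case: (boolP (e \in F)) => eF /=; first by rewrite !andbT => <-.
  case: (boolP (e \in ground M)) => eM; rewrite ?andbF //=.
  by move=> _ _; apply/esym; apply: contraNF eM.
exists (ground M :\: G, set0) => //.
apply: signed_set_eq => e; rewrite /= !inE //.
by case eF: (e \in F); rewrite ?andbF // (subsetP FS _ eF) !andbT.
Qed.

Lemma faces_contraction M R G : R \subset ground M ->
  (G \in faces (contraction M R)) = [disjoint G & R] && (G :|: R \in faces M).
Proof.
move=> RS; rewrite !inE /= subsetD subUset RS andbT.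
case GS: (G \subset ground M) => /=; last by rewrite andbF.
congr andb.
have -> : [disjoint ground M :\: R :\: G :|: set0 & R].
  by rewrite setU0 disjoints_subset; apply/subsetP => e; rewrite !inE => /and3P[].
by rewrite andbT setDDl setUC.
Qed.

(** The positive tope can be moved towards X by eliminating one negative
    element of X at a time. The signs outside A stay positive throughout, so
    when the last negative sign has gone, the elements that vanish form a face
    inside A. *)
Lemma nonneg_outside_face M A X : oriented_matroid M -> acyclic M ->
  X \in covectors M -> ground M :\: A \subset X.1 -> X.1 != ground M ->
  exists G, [/\ G \in faces M, G != set0 & G \subset A].
Proof.
move=> omM acM; have [hS h0 hN hC hE] := omM.
have [n] := ubnP #|X.2|; elim: n => // n IHn in X *.
rewrite ltnS => le_n XM AX Xn.
have /and3P[X1S X2S dX] := hS _ XM.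
have [X20 | [e eX]] := set_0Vmem X.2.
  exists (ground M :\: X.1); split.
  - by apply: face_of_covector => //; rewrite -X20 -surjective_pairing.
  - by apply: contraNneq Xn => /eqP; rewrite setD_eq0 eqEsubset X1S.
  by rewrite subDset setUC -subDset.
have eS := subsetP X2S e eX.
have [Z [ZM eZ hZ]] : exists Z, [/\ Z \in covectors M, e \notin Z.1 :|: Z.2
    & off_separation (ground M, set0) X Z].
  by apply: hE => //; rewrite !inE eS eX.
apply: (IHn Z) => //.
- suff : Z.2 \proper X.2 by move=> /proper_card lt; apply: leq_trans lt le_n.
  apply/properP; split; last by exists e => //; apply: contra eZ;
    rewrite inE orbC => ->.
  apply/subsetP => f fZ; apply: contraLR fZ => fX.
  have [|_ ->] := hZ f; rewrite !inE (negbTE fX) ?andbF //.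
- apply/subsetP => f fA; have fX := subsetP AX _ fA.
  have [|-> _] := hZ f; first by rewrite !inE (disjointFr dX fX) ?andbF.
  by move: fA; rewrite !inE => /andP[_ ->].
by apply: contraNneq eZ => E; rewrite inE E eS.
Qed.

(** An acyclic oriented matroid is controlled by its vertices: a covector that
    is negative somewhere is negative on a whole nonempty face. *)
Lemma negative_part_face M X : oriented_matroid M -> acyclic M ->
  X \in covectors M -> X.2 != set0 ->
  exists G, [/\ G \in faces M, G != set0 & G \subset X.2].
Proof.
move=> omM acM XM /set0Pn[e eX]; have [hS _ _ hC _] := omM.
have /and3P[X1S X2S dX] := hS _ XM.
apply: (nonneg_outside_face omM acM (hC _ _ XM acM)) => /=.
  exact: subsetUr.
apply/eqP => /setP/(_ e); rewrite !inE eX (disjointFl dX eX) /=.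
by rewrite (subsetP X2S e eX).
Qed.

End FacesOfMinorsAndSums.

(** The description of the faces of a stellar subdivision, decided by whether
    the new element belongs to the set. *)
Lemma stellar_faces (U : finType) (a : U) (F : {set U}) (M N : covector_system U)
    (G : {set U}) :
  is_stellar_subdivision a F M N ->
  reflect (if a \in G then [/\ G :\ a \in proper_faces M, ~~ (F \subset G :\ a)
             & exists2 H, H \in proper_faces M & F :|: (G :\ a) \subset H]
           else G \in proper_faces M /\ ~~ (F \subset G))
          (G \in proper_faces N).
Proof.
move=> [[Fp aM gN] [_ _ ->]].
have aout H : H \in proper_faces M -> a \notin H.
  move=> /proper_facesP[/facesP[HS _] _]; apply: contra aM; exact: (subsetP HS).
have iiP : reflect (exists2 H, H \in proper_faces M & F :|: (G :\ a) \subset H)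
    [exists H in proper_faces M, F :|: (G :\ a) \subset H].
  by apply: (iffP existsP) => [[H /andP[]] | [H]]; exists H => //; exact/andP.
rewrite [X in reflect _ X]in_setU; case aG: (a \in G); last first.
  apply: (iffP orP) => [[|/imsetP[H _ GE]] | h]; first by rewrite inE => /andP.
    by rewrite GE setU11 in aG.
  by left; rewrite inE; apply/andP.
apply: (iffP orP) => [[|/imsetP[H]] | [h1 h2 h3]].
- by rewrite inE => /andP[/aout]; rewrite aG.
- rewrite inE => /andP[Hp /andP[FH /existsP[K /andP[Kp HK]]]] GE.
  have GH : G :\ a = H by rewrite GE setU1K // aout.
  by rewrite GH; split=> //; exists K.
right; apply/imsetP; exists (G :\ a); last by rewrite setD1K.
by rewrite inE h1 h2; apply/iiP.
Qed.

(** * Free sums of two oriented matroids *)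

Section FreeSum.
Variables (U : finType) (M M' : covector_system U).
Hypotheses (omM : oriented_matroid M) (omM' : oriented_matroid M').
Hypotheses (acM : acyclic M) (acM' : acyclic M').
Hypotheses (Mn0 : ground M != set0) (M'n0 : ground M' != set0).
Hypothesis dMM' : [disjoint ground M & ground M'].

Let D := relabel Some (direct_sum M M').

Let omD : oriented_matroid D.
Proof.
apply: relabel_oriented_matroid; first exact: Some_inj.
exact: direct_sum_oriented_matroid.
Qed.

Let D_facesE (G : {set U}) : (Some @: G \in faces D) =
  [&& G \subset ground M :|: ground M', G :&: ground M \in faces M
    & G :&: ground M' \in faces M'].
Proof.
rewrite faces_relabel; last exact: Some_inj.
rewrite preimset_imset ?subset_imset_inj; try exact: Some_inj.
by rewrite faces_direct_sum //= andbA andbb.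
Qed.

Let groundM_proper : Some @: ground M \in proper_faces D.
Proof.
apply/proper_facesP; rewrite D_facesE; split.
  rewrite subsetUl setIid ground_face //=.
  by rewrite (disjoint_setI0 dMM'); exact/acyclic_set0.
move=> /imset_inj E; have /set0Pn[e eM'] := M'n0.
move/setP/(_ e): (E (@Some_inj _)); rewrite inE eM' orbT.
by rewrite (disjointFl dMM' eM').
Qed.

Lemma free_sum_exists : exists P, is_free_sum M M' P.
Proof.
have [|||N hN] := @stellar_subdivision_exists _ D (Some @: ground M) None omD _
  groundM_proper.
- apply/(acyclic_set0 D); rewrite -(imset0 Some) D_facesE sub0set !set0I /=.
  by apply/andP; split; exact/acyclic_set0.
- by rewrite imset_eq0.
- by apply/imsetP => -[].
by exists (unrelabel Some (contraction N [set None])); split=> //; exists N.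
Qed.

(** The proper faces of the free sum are the links at the new vertex: those G
    for which the new element and G together form a face of the subdivision.
    Such a G misses part of the first ground set by construction, and part of
    the second because some proper face contains G and the first ground set. *)
Lemma free_sumP P : is_free_sum M M' P ->
  [/\ oriented_matroid P, acyclic P, ground P = ground M :|: ground M'
    & forall G, (G \in proper_faces P) =
       [&& G \subset ground M :|: ground M', G :&: ground M \in proper_faces M
         & G :&: ground M' \in proper_faces M']].
Proof.
move=> [_ [N hN ->]].
have [[_ _ gN] [omN acN _]] := hN.
set P' := unrelabel _ _.
have gP : ground P' = ground M :|: ground M'.
  by apply/setP => e; rewrite !inE gN !inE /= mem_imset ?inE //; exact: Some_inj.
have facesE (G : {set U}) : (G \in faces P') = (None |: Some @: G \in faces N).
  rewrite faces_unrelabel; first last.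
  - by apply/subsetP => -[e|]; rewrite !inE ?codom_f.
  - exact: Some_inj.
  - exact: contraction_oriented_matroid.
  rewrite faces_contraction; last by rewrite sub1set gN setU11.
  rewrite setUC; case: (boolP [disjoint _ & _]) => //=.
  move=> /negP[]; rewrite disjoint_sym disjoints1.
  by apply/imsetP => -[].
have properE (G : {set U}) : (G \in proper_faces P') = (None |: Some @: G \in
  proper_faces N).
  rewrite !in_setD1 facesE gP gN; congr (~~ _ && _).
  apply/eqP/eqP => [-> // | /setP h]; apply/setP => e.
  by move: (h (Some e)); rewrite !in_setU1 /= !mem_imset //; exact: Some_inj.
have pP (G : {set U}) : (G \in proper_faces P') =
       [&& G \subset ground M :|: ground M', G :&: ground M \in proper_faces M
         & G :&: ground M' \in proper_faces M'].
  have dropN : (None |: Some @: G) :\ None = Some @: G.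
    by rewrite setU1K //; apply/imsetP => -[].
  have subE A : (ground A \subset G) = (G :&: ground A == ground A).
    by rewrite (sameP setIidPr eqP).
  rewrite properE; apply/(stellar_faces _ hN)/and3P;
    rewrite setU11 dropN subset_imset_inj; try exact: Some_inj.
    move=> [/proper_facesP[GD Gn] MG [H /proper_facesP[HD Hn] MGH]].
    move: GD; rewrite D_facesE => /and3P[GS GM GM'].
    split=> //; apply/proper_facesP; split=> //; apply/eqP; first by rewrite -subE.
    rewrite -subE; apply: contra_notN Hn => M'G.
    apply/eqP; rewrite eqEsubset; apply/andP; split; first by have /facesP[] := HD.
    apply: subset_trans MGH; rewrite -imsetU subset_imset_inj; last exact: Some_inj.
    by rewrite setUS.
  move=> [GS /proper_facesP[GM /eqP GMn] /proper_facesP[GM' /eqP GM'n]].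
  have GD : Some @: G \in faces D by rewrite D_facesE GS GM GM'.
  rewrite -subE in GMn; rewrite -subE in GM'n.
  split=> //.
    apply/proper_facesP; split=> // /imset_inj E.
    by rewrite (E (@Some_inj _)) subsetUl in GMn.
  exists (Some @: (ground M :|: G)); last by rewrite imsetU.
  apply/proper_facesP; rewrite D_facesE; split.
    rewrite subUset subsetUl GS setUK ground_face //= setIUl.
    by rewrite (disjoint_setI0 dMM') set0U.
  move=> /imset_inj E; case/negP: GM'n; apply/subsetP => e eM'.
  move/setP/(_ e): (E (@Some_inj _)); rewrite !inE eM' orbT (disjointFl dMM' eM').
  by move=> /= ->.
split=> //; first by apply: unrelabel_oriented_matroid;
  exact: contraction_oriented_matroid.
apply/acyclic_set0; suff /proper_facesP[] : set0 \in proper_faces P' by [].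
rewrite pP sub0set !set0I /=; apply/andP; split; apply/proper_facesP; split.
- exact/acyclic_set0.
- by apply/eqP; rewrite eq_sym.
- exact/acyclic_set0.
by apply/eqP; rewrite eq_sym.
Qed.

End FreeSum.

(** * Iterated stellar subdivisions *)

Section Walk.
Variables (U : finType) (M : covector_system U).
Hypothesis omM : oriented_matroid M.
Implicit Types (A : {set {set U}}) (s : seq {set U}) (G H J X Y : {set U}).

(** The join of X in the face lattice. *)
Definition face_closure X : {set U} :=
  ground M :&: \bigcap_(G in faces M | X \subset G) G.

Lemma face_closure_face X : face_closure X \in faces M.
Proof.
rewrite /face_closure.
elim/big_ind: _ => [|G H GM HM|G /andP[GM _]]; first by rewrite setIT ground_face.
  by rewrite -(setIid (ground M)) setIACA faces_setI.
by rewrite faces_setI // ground_face.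
Qed.

Lemma face_closure_ground X : face_closure X \subset ground M.
Proof. exact: subsetIl. Qed.

Lemma sub_face_closure X : X \subset ground M -> X \subset face_closure X.
Proof. by move=> XS; rewrite subsetI XS; apply/bigcapsP => G /andP[]. Qed.

Lemma face_closure_min X G : G \in faces M -> X \subset G ->
  face_closure X \subset G.
Proof.
move=> GM XG; apply: subset_trans (subsetIr _ _) _.
by apply: (bigcap_inf G); rewrite GM.
Qed.

Lemma face_closureS X Y : X \subset Y -> face_closure X \subset face_closure Y.
Proof.
move=> XY; rewrite subsetI face_closure_ground /=.
apply/bigcapsP => G /andP[GM YG].
by apply: face_closure_min => //; exact: subset_trans YG.
Qed.

Lemma face_closure_id G : G \in faces M -> face_closure G = G.
Proof.
move=> GM; apply/eqP; rewrite eqEsubset face_closure_min //=.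
by apply: sub_face_closure; have /facesP[] := GM.
Qed.

Lemma face_closureU X Y : X \subset ground M -> Y \subset ground M ->
  face_closure (face_closure X :|: Y) = face_closure (X :|: Y).
Proof.
move=> XS YS; apply/eqP; rewrite eqEsubset; apply/andP; split.
  apply: face_closure_min; first exact: face_closure_face.
  rewrite subUset face_closureS ?subsetUl //=.
  apply: subset_trans (subsetUr X Y) _.
  by apply: sub_face_closure; rewrite subUset XS.
by apply: face_closureS; rewrite setSU // sub_face_closure.
Qed.

(** This test recognizes the proper faces of the iterated subdivision along s:
    the new elements A together with the old elements G form a face when,
    going through s from the face subdivided last to the one subdivided first,
    no member of s is contained in the current face, where the current face
    starts as G and is joined with every member of A on the way, and stays
    proper. *)
Fixpoint walk s A G : bool :=
  if s is H :: s' then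
    ~~ (H \subset G) && walk s' A (if H \in A then face_closure (G :|: H) else G)
  else G != ground M.

(** Smaller sets of elements keep all the intermediate faces smaller. Hence
    the sets passing the test are closed under taking subsets. *)
Lemma walkS s A A' G G' :
  {in s, forall H : {set U}, H \subset ground M} -> {in s, forall H, H \in A -> H \in
    A'} ->
  G \subset G' -> G' \subset ground M -> walk s A' G' -> walk s A G.
Proof.
elim: s G G' => /= [|H s IHs] G G' sS sA GG' G'S.
  apply: contraNneq => E; rewrite eqEsubset G'S -E //.
have HS : H \subset ground M by apply: sS; rewrite mem_head.
have sS' : {in s, forall H : {set U}, H \subset ground M} by move=> D Ds; apply: sS;
  rewrite in_cons Ds orbT.
have sA' : {in s, forall H, H \in A -> H \in A'} by move=> D Ds; apply: sA;
  rewrite in_cons Ds orbT.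
have G'HS : G' :|: H \subset ground M by rewrite subUset G'S.
move=> /andP[HG']; rewrite (contra _ HG') /=; last by move=> HG;
  exact: subset_trans GG'.
case: ifP => HA'.
  apply: IHs => //; last exact: face_closure_ground.
  case: ifP => _; first by apply: face_closureS; exact: setSU.
  exact: subset_trans (subset_trans GG' (subsetUl _ H)) (sub_face_closure _).
apply: IHs => //; case: ifP => // HA.
by rewrite (sA H (mem_head _ _) HA) in HA'.
Qed.

Lemma walk0 s G : walk s set0 G = all (fun H => ~~ (H \subset G)) s && (G != ground M).
Proof. by elim: s => //= H s IHs; rewrite in_set0 IHs andbA. Qed.

(** The face at which a walk stands after it has passed the members of s. *)
Definition reached s A G : {set U} :=
  face_closure (G :|: cover [set B in A | B \in s]).

Lemma reached_nil A G : G \in faces M -> reached [::] A G = G.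
Proof.
move=> GM; rewrite /reached.
have -> : [set B in A | B \in [::]] = set0 by apply/setP => B; rewrite !inE andbF.
by rewrite /cover big_set0 setU0 face_closure_id.
Qed.

Lemma reached_cons H s A G : G \in faces M ->
  {in H :: s, forall D : {set U}, D \subset ground M} ->
  reached (H :: s) A G =
  reached s A (if H \in A then face_closure (G :|: H) else G).
Proof.
move=> /facesP[GS _] sS; rewrite /reached; case: ifP => HA; last first.
  congr (face_closure (_ :|: cover _)); apply/setP => B; rewrite !inE.
  by case: eqP => // ->; rewrite HA.
rewrite face_closureU.
- rewrite -setUA; congr (face_closure (_ :|: _)).
  have -> : [set B in A | B \in H :: s] = H |: [set B in A | B \in s].
    by apply/setP => B; rewrite !inE; case: eqP => // ->; rewrite HA.
  apply/setP => e; apply/bigcupP/setUP => [[B] | [eH | /bigcupP[B BA eB]]].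
  + by rewrite in_setU1 => /orP[/eqP->|BA] eB; [left | right; apply/bigcupP; exists B].
  + by exists H => //; rewrite setU11.
  by exists B => //; rewrite in_setU1 BA orbT.
- by rewrite subUset GS sS ?mem_head.
by apply/bigcupsP => B; rewrite inE => /andP[_ Bs]; apply: sS; rewrite in_cons Bs orbT.
Qed.

Lemma walkP s A G : G \in faces M -> {in s, forall D : {set U}, D \subset ground M} ->
  walk s A G <->
  (forall s1 J s2, s = s1 ++ J :: s2 -> ~~ (J \subset reached s1 A G)) /\
  reached s A G <> ground M.
Proof.
elim: s G => [|H s IHs] G GM sS.
  rewrite reached_nil //=; split=> [/eqP h|[_ h]]; last exact/eqP.
  by split=> // -[|? ?] ? ?.
have sS' : {in s, forall H : {set U}, H \subset ground M} by move=> D Ds; apply: sS;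
  rewrite in_cons Ds orbT.
set G' := if H \in A then face_closure (G :|: H) else G.
have G'M : G' \in faces M by rewrite /G'; case: ifP => // _; exact: face_closure_face.
rewrite /= reached_cons // -/G'; split=> [/andP[HG] | [hs hS]].
  move=> /(IHs G' G'M sS')[hs hS]; split=> // -[|D s1] J s2 /= [<- E].
    by rewrite reached_nil.
  rewrite reached_cons //; first exact: hs E.
  move=> B; rewrite in_cons => /orP[/eqP->|Bs]; apply: sS; rewrite ?mem_head //.
  by rewrite E in_cons mem_cat Bs orbT.
apply/andP; split; first by rewrite -(reached_nil A GM); exact: hs.
apply/(IHs G' G'M sS'); split=> // s1 J s2 E.
rewrite -reached_cons //; first by apply: (hs (H :: s1) J s2); rewrite E.
move=> B; rewrite in_cons => /orP[/eqP->|Bs]; apply: sS; rewrite ?mem_head //.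
by rewrite E in_cons mem_cat Bs orbT.
Qed.

End Walk.

Section IteratedSubdivision.
Variables (U : finType) (M : covector_system U).
Hypotheses (omM : oriented_matroid M) (acM : acyclic M).
Implicit Types (A : {set {set U}}) (s : seq {set U}) (G H : {set U}).
Local Notation T := (U + {set U})%type.

(** A set of old elements and a set of new elements, seen in the ground set of
    the iterated subdivision. *)
Definition elements G A : {set T} := inl @: G :|: inr @: A.

Lemma elements_inl G A : inl @^-1: elements G A = G.
Proof.
apply/setP => e; rewrite !inE mem_imset; last by move=> ? ? [].
by rewrite orbC; case: imsetP => // -[].
Qed.

Lemma elements_inr G A : inr @^-1: elements G A = A.
Proof.
apply/setP => e; rewrite !inE mem_imset; last by move=> ? ? [].
by case: imsetP => // -[].
Qed.

Lemma elementsE (K : {set T}) : K = elements (inl @^-1: K) (inr @^-1: K).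
Proof.
apply/setP => -[e|B]; rewrite inE mem_imset ?inE; try by move=> ? ? [].
  by case: imsetP => [[]|]; rewrite ?orbF.
by case: imsetP => [[]|].
Qed.

Lemma elements_subset G A (K : {set T}) :
  (elements G A \subset K) = (G \subset inl @^-1: K) && (A \subset inr @^-1: K).
Proof. by rewrite subUset !sub_imset_pre. Qed.

(** Each stellar subdivision at H adds one step to the walk. A face without
    the new element must not contain H. A face with the new element requires a
    previous face above it that contains H, and by walkS there is one as soon
    as the join of its old part with H passes the remaining test. *)
Lemma iterated_subdivisionP s N :
  uniq s -> {in s, forall H : {set U}, H \subset ground M} ->
  is_iterated_subdivision s M N ->
  [/\ oriented_matroid N, acyclic N, ground N = elements (ground M) [set H in s]
    & forall K, (K \in proper_faces N) =
      [&& inl @^-1: K \in faces M, inr @^-1: K \subset s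
        & walk M s (inr @^-1: K) (inl @^-1: K)]].
Proof.
have inlI : injective (@inl U {set U}) by move=> ? ? [].
have inrI : injective (@inr U {set U}) by move=> ? ? [].
elim: s N => [|H s IHs] N /=.
  move=> _ _ ->.
  have omN := relabel_oriented_matroid inlI omM.
  have gN : ground (relabel inl M) = elements (ground M) [set H in [::]].
    rewrite /elements; have -> : [set H : {set U} in [::]] = set0.
      by apply/setP => B; rewrite !inE.
    by rewrite imset0 setU0.
  split=> //.
    apply/acyclic_set0; rewrite faces_relabel // sub0set preimset0 /=.
    exact/acyclic_set0.
  move=> K; rewrite /proper_faces in_setD1 faces_relabel //=.
  have -> : (K \subset inl @: ground M) = (inl @^-1: K \subset ground M) && (inr @^-1:
    K \subset [::]).
    rewrite {1}[K]elementsE elements_subset preimset_imset //; congr (_ && _).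
    apply/subsetP/subsetP => h B BK; have := h B BK; last by [].
    by rewrite inE => /imsetP[].
  case KM: (_ \in faces M); rewrite ?andbF //= andbT.
  have /facesP[-> _] := KM; rewrite /=.
  case K0: (_ \subset [::]); rewrite ?andbF //= andbT.
  congr negb; rewrite {1}[K]elementsE.
  have -> : inr @^-1: K = set0 by apply/setP => B; rewrite !inE;
    apply/negbTE/negP => BK; have := subsetP K0 B; rewrite inE => /(_ BK).
  rewrite /elements imset0 setU0; apply/eqP/eqP => [/imset_inj|->//]; exact.
move=> /andP[Hs us] sS [N' /(IHs N' us)[]].
  by move=> D Ds; apply: sS; rewrite in_cons Ds orbT.
move=> omN' acN' gN' hN' st; have [[_ _ gN] [omN acN _]] := st.
have sS' : {in s, forall D : {set U}, D \subset ground M}.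
  by move=> D Ds; apply: sS; rewrite in_cons Ds orbT.
have HS : H \subset ground M by apply: sS; rewrite mem_head.
split=> //.
  have lr e (B : {set {set U}}) : (inl e \in inr @: B) = false by apply/imsetP => -[].
  have rl e (B : {set U}) : (inr e \in inl @: B) = false by apply/imsetP => -[].
  by rewrite gN gN'; apply/setP => -[e|B]; rewrite !inE ?lr ?rl ?mem_imset // !inE.
move=> K; set A := inr @^-1: K; set G := inl @^-1: K.
have KH : (inr H \in K) = (H \in A) by rewrite inE.
have preD : inl @^-1: (K :\ inr H) = G /\ inr @^-1: (K :\ inr H) = A :\ H.
  by split; apply/setP => e; rewrite !inE.
have HG : (inl @: H \subset K) = (H \subset G) by rewrite sub_imset_pre.
have HG' : (inl @: H \subset K :\ inr H) = (H \subset G).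
  by rewrite sub_imset_pre; case: preD => ->.
apply/(stellar_faces K st)/and3P; rewrite KH.
  case: ifP => HA.
    rewrite hN'; case: preD => -> ->; rewrite HG'.
    move=> [/and3P[GM As wG] HGn [K' + HK']]; rewrite hN' => /and3P[G'M As' wG'].
    split=> //.
      apply/subsetP => B BA; rewrite in_cons; case: eqP => //= /eqP BH.
      by apply: (subsetP As); rewrite in_setD1 BH.
    rewrite HGn /=; apply: walkS wG' => //; last by have /facesP[] := G'M.
      move=> B Bs BA; rewrite inE; apply: (subsetP HK'); rewrite !inE.
      apply/orP; right; rewrite -[inr B \in K]/(_) -/A; move: BA; rewrite inE => ->;
        rewrite andbT.
      by apply: contraNneq Hs => -[<-].
    apply: face_closure_min => //; apply/subsetP => e; rewrite !inE => eGH.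
    apply: (subsetP HK'); rewrite !inE mem_imset //.
    by case/orP: eGH => ->; rewrite ?orbT.
  rewrite hN' HG -/A -/G => -[/and3P[GM As wG] HGn]; split=> //.
    by apply: subset_trans As _; apply/subsetP => B; rewrite in_cons orbC => ->.
  by rewrite HGn.
move=> [GM As] /= /andP[HGn]; case: ifP => HA wG; last first.
  split; last by rewrite HG.
  rewrite hN' -/A -/G GM wG andbT /=; apply/subsetP => B BA.
  have := subsetP As B BA; rewrite in_cons; case: eqP => // BH.
  by rewrite -BH BA in HA.
have GS : G \subset ground M by have /facesP[] := GM.
have As' : A :\ H \subset s.
  apply/subsetP => B; rewrite in_setD1 => /andP[BH BA].
  by have := subsetP As B BA; rewrite in_cons (negbTE BH).
have sA : {in s, forall D, D \in A :\ H -> D \in A} by move=> D _;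
  rewrite in_setD1 => /andP[].
have subcl : G :|: H \subset face_closure M (G :|: H).
  by apply: sub_face_closure; rewrite subUset GS.
split; rewrite ?HG' //.
  rewrite hN'; case: preD => -> ->; rewrite GM As' /=.
  apply: walkS wG => //; last exact: face_closure_ground.
  exact: subset_trans (subsetUl _ _) subcl.
exists (elements (face_closure M (G :|: H)) (A :\ H)).
  rewrite hN' elements_inl elements_inr face_closure_face // As' /=.
  by apply: walkS wG => //; exact: face_closure_ground.
rewrite subUset sub_imset_pre elements_inl; apply/andP; split.
  exact: subset_trans (subsetUr _ _) subcl.
rewrite [K :\ _]elementsE elements_subset elements_inl elements_inr.
case: preD => -> ->; rewrite subxx andbT.
exact: subset_trans (subsetUl _ _) subcl.
Qed.

(** Because larger faces are subdivided first, H contains no face subdivided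
    before it, so it is still a face when its turn comes. *)
Lemma iterated_subdivision_exists s :
  uniq s -> {in s, forall H, H \in proper_faces M /\ H != set0} ->
  pairwise (fun G H : {set U} => ~~ (H \subset G)) s ->
  exists N, is_iterated_subdivision s M N.
Proof.
elim: s => [|H s IHs] /=; first by exists (relabel inl M).
move=> /andP[Hs us] sM /andP[Hall pw].
have sM' : {in s, forall D, D \in proper_faces M /\ D != set0}.
  by move=> D Ds; apply: sM; rewrite in_cons Ds orbT.
have sS : {in s, forall D : {set U}, D \subset ground M}.
  by move=> D /sM'[/proper_facesP[/facesP[]]].
have [N' hN'] := IHs us sM' pw.
have [omN' acN' gN' facesN'] := iterated_subdivisionP us sS hN'.
have [/proper_facesP[HM /eqP Hn] Hn0] := sM H (mem_head _ _).
have [|||N hN] := @stellar_subdivision_exists _ N' (inl @: H) (inr H) omN' acN'.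
- have -> : inl @: H = elements H set0 by rewrite /elements imset0 setU0.
  rewrite facesN' elements_inl elements_inr HM walk0 Hn andbT /=.
  by apply/andP; split=> //; apply/subsetP => B; rewrite inE.
- by rewrite imset_eq0.
- rewrite gN' !inE mem_imset; last by move=> ? ? [].
  by rewrite inE (negbTE Hs) orbF; apply/imsetP => -[].
by exists N, N'.
Qed.

End IteratedSubdivision.

(** * Building sets and nested sets *)

Section Kappa.
Variable U : finType.
Implicit Types (F : {set {set U}}) (B C D : {set U}).

Lemma kappaP F B :
  reflect (B \in F /\ forall C, C \in F -> B \subset C -> C = B) (B \in kappa F).
Proof. by rewrite inE; exact: maxsetP. Qed.

Lemma kappa_above F D : D \in F -> exists2 B, B \in kappa F & D \subset B.
Proof. by move=> /(@maxset_exists _ (fun C => C \in F))[B]; exists B => //;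
  rewrite inE. Qed.

Lemma kappa_subset F : kappa F \subset F.
Proof. by apply/subsetP => B /kappaP[]. Qed.

Lemma kappa_antichain F : antichain (kappa F).
Proof.
apply/forall_inP => B /kappaP[_ Bmax]; apply/forall_inP => C /kappaP[CF _].
by apply/implyP => BC; rewrite (Bmax C).
Qed.

End Kappa.

Section BuildingSet.
Variables (U : finType) (M : covector_system U) (F : {set {set U}}).
Hypotheses (omM : oriented_matroid M) (acM : acyclic M).
Hypothesis bsF : facial_building_set (F, M).
Implicit Types (L A : {set {set U}}) (B C D E G J X Y : {set U}).
Local Notation cl := (face_closure M).

Lemma building_faces D : D \in F -> D \in faces M /\ D != set0.
Proof. by case: bsF => /subsetP/(_ D) + _ => /[apply]; rewrite in_setD1 => /andP[]. Qed.

Lemma building_ground D : D \in F -> D \subset ground M.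
Proof. by move=> /building_faces[/facesP[]]. Qed.

Lemma below_prodP L A (x : {ffun {set U} -> {set U}}) :
  reflect ((forall C, C \notin A -> x C = set0) /\
           forall C, C \in A -> x C \in below L C) (x \in below_prod L A).
Proof.
rewrite inE; apply: (iffP pfamilyP) => -[h1 h2]; split=> //.
  by move=> C CA; apply/eqP; apply: contraNT CA => xC; exact: (subsetP h1).
by apply/subsetP => C; apply: contraR => CA; rewrite h1.
Qed.

Lemma in_component_below L A B G :
  set0 \in L -> B \in A -> G \in below L B -> in_component B G \in below_prod L A.
Proof.
move=> L0 BA GB; apply/below_prodP; split=> C CA; rewrite ffunE.
  by case: eqP => // CB; rewrite CB BA in CA.
by case: eqP => [->//|_]; rewrite inE L0 sub0set.
Qed.

(** Comparisons with a family supported at one factor only test that factor;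
    this is how the product decomposition is used throughout. *)
Lemma in_component_le B G (x : {ffun {set U} -> {set U}}) :
  le_family (in_component B G) x = (G \subset x B).
Proof.
apply/forallP/idP => [/(_ B)|GB C]; first by rewrite ffunE eqxx.
by rewrite ffunE; case: eqP => [->//|_]; exact: sub0set.
Qed.

(** Without a factor below G the product would be a point, while the interval
    below G has two elements. *)
Lemma building_below G : G \in faces M -> G != set0 ->
  exists2 D, D \in F & D \subset G.
Proof.
move=> GM Gn0; have [_ /(_ G)[|phi [[_ im _] _]]] := bsF.
  by rewrite in_setD1 Gn0.
have [k0 | [B /kappaP[+ _]]] := set_0Vmem (kappa (below F G)); last first.
  by rewrite inE => /andP[]; exists B.
have L0 : set0 \in faces M by exact/acyclic_set0.
have /imsetP[x /below_prodP[x0 _] Ex] : G \in phi @: below_prod (faces M) (kappa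
  (below F G)).
  by rewrite im inE GM subxx.
have /imsetP[y /below_prodP[y0 _] Ey] : set0 \in phi @: below_prod (faces M) (kappa
  (below F G)).
  by rewrite im inE L0 sub0set.
case/eqP: Gn0; rewrite Ex Ey; congr phi; apply/ffunP => C.
by rewrite x0 ?y0 // k0 inE.
Qed.

(** A common nonempty face would be the image of two different elements of the
    product, one supported at B and one at C. *)
Lemma kappa_disjoint B C : B \in kappa F -> C \in kappa F -> B != C ->
  B :&: C = set0.
Proof.
move=> Bk Ck BC; apply/eqP; apply: contraNT BC => En0.
have BF := subsetP (kappa_subset F) _ Bk; have CF := subsetP (kappa_subset F) _ Ck.
have [BM Bn0] := building_faces BF; have [CM Cn0] := building_faces CF.
have EM := faces_setI omM BM CM.
have belowF : below F (ground M) = F.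
  by apply/setP => D; rewrite inE andb_idr //; exact: building_ground.
have [_ /(_ (ground M))[|phi [[inj _ _] comp]]] := bsF.
  rewrite in_setD1 ground_face // andbT.
  by apply: contraNneq Bn0 => S0; rewrite -subset0 -S0 building_ground.
rewrite belowF in inj comp.
have L0 : set0 \in faces M by exact/acyclic_set0.
have EB : B :&: C \in below (faces M) B by rewrite inE EM subsetIl.
have EC : B :&: C \in below (faces M) C by rewrite inE EM subsetIr.
have /ffunP/(_ B) : in_component B (B :&: C) = in_component C (B :&: C).
  by apply: inj; rewrite ?in_component_below // !comp.
by rewrite !ffunE eqxx; case: eqP => // _ E0; rewrite E0 eqxx in En0.
Qed.

(** In the product of the intervals below the factors of X, joins are taken
    factor by factor, so the members of A below the factor B must have join B
    for A to have join X. *)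
Lemma factor_spanned A B : A \subset F -> B \in kappa (below F (cl (cover A))) ->
  cl (cover [set C in A | C \subset B]) = B.
Proof.
move=> AF Bk; set X := cl (cover A) in Bk *; set B' := cl _.
have XM : X \in faces M by exact: face_closure_face.
have L0 : set0 \in faces M by exact/acyclic_set0.
have kF D : D \in kappa (below F X) -> D \in F /\ D \subset X.
  by move=> /(subsetP (kappa_subset _)); rewrite inE => /andP[].
have [BF BX] := kF B Bk; have [BM Bn0] := building_faces BF.
have AS : cover A \subset ground M.
  by apply/bigcupsP => C /(subsetP AF); exact: building_ground.
have AX C : C \in A -> C \subset X.
  by move=> CA; apply: subset_trans (sub_face_closure AS); exact: bigcup_sup.
have B'M : B' \in faces M by exact: face_closure_face.
have B'B : B' \subset B.
  by apply: face_closure_min => //; apply/bigcupsP => C; rewrite inE => /andP[].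
apply/eqP; rewrite eqEsubset B'B /=.
have [_ /(_ X)[|phi [[_ im mono] comp]]] := bsF.
  by rewrite in_setD1 XM andbT; apply: contraNneq Bn0 => X0; rewrite -subset0 -X0.
set k := kappa (below F X) in Bk kF im mono comp.
(* The family of all the factors of X, with B shrunk to the join of the members
   of A below it; its image still contains every member of A. *)
pose x : {ffun {set U} -> {set U}} :=
  [ffun C => if C == B then B' else if C \in k then C else set0].
have xP : x \in below_prod (faces M) k.
  apply/below_prodP; split=> C Ck; rewrite ffunE.
    by case: eqP => [CB|_]; [rewrite CB Bk in Ck | rewrite (negbTE Ck)].
  case: eqP => [->|_]; first by rewrite inE B'M.
  by rewrite Ck inE subxx andbT; have [/building_faces[]] := kF C Ck.
have xB D G : D \in k -> G \in below (faces M) D -> (G \subset phi x) = (G \subset x D).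
  move=> Dk GD; rewrite -{1}(comp D G Dk GD) -in_component_le.
  by apply: mono => //; exact: in_component_below.
have self D : D \in k -> D \in below (faces M) D.
  by move=> /kF[/building_faces[DM _] _]; rewrite inE DM subxx.
have : B \subset phi x.
  apply: subset_trans BX _; apply: face_closure_min.
    have : phi x \in below (faces M) X by rewrite -im imset_f.
    by rewrite inE => /andP[].
  apply/bigcupsP => C CA; case CB: (C \subset B).
    apply: subset_trans (_ : B' \subset _).
      apply: subset_trans (sub_face_closure _); first by apply: bigcup_sup;
        rewrite inE CA.
      by apply: subset_trans AS; apply/bigcupsP => D; rewrite inE => /andP[DA _];
        exact: bigcup_sup.
    by rewrite (xB B) ?ffunE ?eqxx // inE B'M.
  have [|D Dk CD] := @kappa_above _ (below F X) C.
    by rewrite inE (subsetP AF) //= AX.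
  apply: (subset_trans CD); rewrite (xB D) ?self // ffunE.
  case: eqP => [DB|_]; last by rewrite Dk.
  by rewrite DB in CD; rewrite CD in CB.
by rewrite (xB B) ?self // ffunE eqxx.
Qed.

Definition no_join_of_antichain A : Prop := forall A', A' \subset A -> 1 < #|A'| ->
  antichain A' -> forall J, J \in F -> ~~ is_join (faces M) A' J.

Lemma no_join_of_antichainS A A' : A' \subset A ->
  no_join_of_antichain A -> no_join_of_antichain A'.
Proof. by move=> AA' h A'' /subset_trans/(_ AA'); exact: h. Qed.

(** The join of a nested set generates no new members of F. The factor B above
    D is the join of the maximal members of A below it, which form an
    antichain; since B belongs to F, the antichain has a single member, namely
    B itself. *)
Lemma nested_below_closure A D : A \subset F -> no_join_of_antichain A ->
  D \in F -> D \subset cl (cover A) -> exists2 C, C \in A & D \subset C.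
Proof.
move=> AF njA DF DX.
have [|B Bk DB] := @kappa_above _ (below F (cl (cover A))) D; first by rewrite inE DF.
have BF : B \in F by move: (subsetP (kappa_subset _) _ Bk); rewrite inE => /andP[].
have [BM Bn0] := building_faces BF.
have EB := factor_spanned AF Bk; set A1 := [set C in A | _] in EB.
(* A1 and its maximal members have the same upper bounds. *)
have coverE G : cover (kappa A1) \subset G -> cover A1 \subset G.
  move=> kG; apply/bigcupsP => C /kappa_above[C' C'k CC'].
  by apply: subset_trans CC' (subset_trans (bigcup_sup C' C'k) kG).
have jB G : G \in faces M -> cover (kappa A1) \subset G -> B \subset G.
  by move=> GM /coverE; rewrite -EB; exact: face_closure_min.
have kA1 C : C \in kappa A1 -> C \in A /\ C \subset B.
  by move=> /(subsetP (kappa_subset _)); rewrite inE => /andP[].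
have kA : kappa A1 \subset A by apply/subsetP => C /kA1[].
have joinB : is_join (faces M) (kappa A1) B.
  apply/and3P; split=> //; first by apply/bigcupsP => C /kA1[].
  by apply/forall_inP => G GM; apply/implyP; exact: jB.
have : ~~ (1 < #|kappa A1|).
  by apply: contraL joinB => c1; apply: njA => //; exact: kappa_antichain.
rewrite -leqNgt leq_eqVlt ltnS leqn0 => /orP[/cards1P[C kC] | /eqP/cards0_eq k0].
  have /kA1[CA _] : C \in kappa A1 by rewrite kC set11.
  exists C => //; apply: subset_trans DB (jB _ _ _); last by rewrite kC /cover big_set1.
  by have [] := building_faces (subsetP AF _ CA).
case/eqP: Bn0; apply/eqP; rewrite -subset0; apply: jB; first exact/acyclic_set0.
by rewrite k0 /cover big_set0.
Qed.

Lemma nested_complexP A : reflect (A \subset F :\: kappa F /\ no_join_of_antichain A)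
  (A \in nested_complex (faces M) F).
Proof.
apply: (iffP imsetP) => [[N + ->] | [AF njA]].
  rewrite inE => /and3P[kN NF /forallP nj]; split; first exact: setSD.
  move=> A' A'N c1 ac J JF; have /implyP := nj A'; rewrite A'N c1 ac => /(_ isT).
  by move=> /forall_inP/(_ J JF).
have dk : (A :|: kappa F) :\: kappa F = A.
  apply/setP => B; rewrite in_setD in_setU.
  case: (boolP (B \in A)) => [BA | _] /=; last exact: andNb.
  by have := subsetP AF _ BA; rewrite in_setD andbT => /andP[].
exists (A :|: kappa F); last by rewrite dk.
rewrite inE; apply/and3P; split; first exact: subsetUr.
  by rewrite subUset kappa_subset andbT; apply: subset_trans AF _; exact: subsetDl.
apply/forallP => A'; apply/implyP; rewrite dk => /and3P[A'A c1 ac].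
by apply/forall_inP => J JF; exact: njA.
Qed.

End BuildingSet.

(** * Restriction to the new elements *)

Section RestrictToNewElements.
Variables (U : finType) (N : covector_system (U + {set U})%type) (F : {set {set U}}).
Hypotheses (omN : oriented_matroid N) (acN : acyclic N).
Hypothesis Fground : inr @: F \subset ground N.
Hypothesis Fn0 : F != set0.
Hypothesis new_faces : forall K, K \in proper_faces N -> K \subset inr @: F.

(** Dropping the old elements keeps the face poset when every proper face
    consists of new elements. A covector that is nonnegative on the new
    elements is nonnegative everywhere, since otherwise negative_part_face
    gives a nonempty face, hence a new element, where it is negative. The same
    lemma, applied to an opposite covector, shows that the new elements do not
    all lie on one proper face. *)
Lemma face_semilattice_new_elements :
  face_semilattice (unrelabel inr (restriction N (inr @: F))) =
  [set A : {set {set U}} | inr @: A \in proper_faces N].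
Proof.
have inrI : injective (@inr U {set U}) by move=> ? ? [].
have [hS _ hN _ _] := omN.
set Q := unrelabel _ _.
have gQ : ground Q = F.
  by rewrite /Q /= (setIidPr Fground) preimset_imset.
have meetsR G : G \in faces N -> G != set0 -> exists2 B, B \in F & inr B \in G.
  move=> GN Gn0; have [GE | /eqP Gn] := eqVneq G (ground N).
    have /set0Pn[B BF] := Fn0; exists B => //; rewrite GE.
    by apply: (subsetP Fground); rewrite mem_imset.
  have /new_faces GR : G \in proper_faces N by apply/proper_facesP.
  have /set0Pn[e eG] := Gn0; have /imsetP[B BF eB] := subsetP GR e eG.
  by exists B; rewrite -?eB.
rewrite /face_semilattice gQ (negbTE Fn0); apply/setP => A.
rewrite in_setD1 gQ !inE gQ;
  apply/and3P/andP => [[An AF /imsetP[_ /imsetP[X XN ->]]] | [/eqP An /andP[AS AN]]].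
  move=> [/setP E1 /setP E2].
  have X20 : X.2 = set0.
    apply/eqP; apply: contraT => /(negative_part_face omN acN XN)[G [GN Gn0 GX]].
    have [B BF BG] := meetsR G GN Gn0.
    by have := E2 B; rewrite !inE (subsetP GX) // mem_imset ?BF.
  have XN' : (X.1, set0) \in covectors N by rewrite -X20 -surjective_pairing.
  have GN := face_of_covector omN XN'.
  have Gn : ground N :\: X.1 <> ground N.
    move=> GE; case/eqP: An; apply/setP => B.
    have := E1 B; rewrite !inE mem_imset //; case BF: (B \in F); last first.
      by move=> _; apply: contraFF BF; exact: (subsetP AF).
    rewrite !andbT.
    have BN : inr B \in ground N by apply: (subsetP Fground); rewrite mem_imset.
    by move/setP/(_ (inr B)): GE; rewrite in_setD BN andbT => /negbTE-> /negbFE.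
  suff -> : inr @: A = ground N :\: X.1.
    by split; [exact/eqP | move: GN; rewrite inE].
  have /new_faces GR : ground N :\: X.1 \in proper_faces N by apply/proper_facesP.
  have AE B : B \in F -> (B \in A) = (inr B \notin X.1).
    by move=> BF; have := E1 B; rewrite !inE mem_imset // BF !andbT => <-;
      rewrite negbK.
  apply/setP => g; apply/imsetP/idP => [[B BA ->] | gG].
    have BF := subsetP AF _ BA; rewrite in_setD -AE // BA.
    by apply: (subsetP Fground); rewrite mem_imset.
  have /imsetP[B BF gE] := subsetP GR g gG; exists B => //.
  by rewrite AE // -gE; move: gG; rewrite in_setD => /andP[].
have Ap : inr @: A \in proper_faces N by apply/proper_facesP; rewrite inE AS.
have AF : A \subset F by have := new_faces Ap; rewrite subset_imset_inj.
split=> //.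
  apply/eqP => AE; rewrite AE in AN An.
  have XN := hN _ AN.
  have [|G [GN Gn0 GX]] := negative_part_face omN acN XN.
    rewrite /=; apply: contra_not_neq An => E; apply/eqP; rewrite eqEsubset Fground /=.
    by rewrite -setD_eq0 E.
  have [B BF /(subsetP GX)] := meetsR G GN Gn0.
  by rewrite /= in_setD mem_imset // BF.
apply/imsetP; exists (ssrestr (inr @: F) (ground N :\: inr @: A, set0));
  first exact: imset_f.
apply: signed_set_eq => B; rewrite /= !inE // !mem_imset //.
case BF: (B \in F); rewrite ?andbF // !andbT (subsetP Fground) ?andbT //.
by rewrite mem_imset.
Qed.

End RestrictToNewElements.

(** * Iterated free sums *)

Section IteratedFreeSum.
Variables (U : finType) (M : covector_system U) (F : {set {set U}}).
Hypotheses (omM : oriented_matroid M) (acM : acyclic M).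
Implicit Types (p q r : facial_pair U) (G Fi : {set U}) (Fs : seq {set U}).

Lemma restriction_acyclic R : acyclic (restriction M R).
Proof.
apply/imsetP; exists (ground M, set0) => //.
by rewrite /ssrestr /= set0I.
Qed.

(** Existence and description go together in one induction: each step needs
    the partial sum to be an acyclic oriented matroid on a nonempty ground set
    that is disjoint from the remaining summands. *)
Lemma iterated_free_sum_from Fs p :
  oriented_matroid p.2 -> acyclic p.2 -> ground p.2 != set0 ->
  {in p.1, forall D : {set U}, D \subset ground p.2} ->
  {in Fs, forall Fi : {set U}, [/\ Fi \in faces M, Fi != set0 & [disjoint ground p.2 &
    Fi]]} ->
  pairwise (fun A B : {set U} => [disjoint A & B]) Fs ->
  let summands := [seq (below F Fi, restriction M Fi) | Fi <- Fs] in
  (exists r, is_free_sum_from p summands r) /\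
  (forall r, is_free_sum_from p summands r ->
    [/\ oriented_matroid r.2, acyclic r.2,
      forall e, (e \in ground r.2) = (e \in ground p.2) || has (fun Fi => e \in Fi) Fs,
      forall D, (D \in r.1 :\ ground r.2) =
        (D \in p.1 :\ ground p.2) || has (fun Fi => D \in below F Fi :\ Fi) Fs
    & forall G, (G \in proper_faces r.2) =
        [&& G \subset ground r.2, G :&: ground p.2 \in proper_faces p.2
          & all (fun Fi => G :&: Fi \in proper_faces (restriction M Fi)) Fs]]).
Proof.
elim: Fs p => [|F1 Fs IHs] p omp acp pn0 pS FsP pw /=.
  split; first by exists p.
  move=> _ ->; split=> // [e|D|G]; rewrite ?orbF // andbT.
  case GS: (G \subset _); first by rewrite (setIidPl GS).
  by apply: contraFF GS => /proper_facesP[/facesP[]].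
have [F1M F1n0 dF1] := FsP F1 (mem_head _ _).
have gF1 : ground (restriction M F1) = F1 by apply/setIidPr; have /facesP[] := F1M.
have om1 := restriction_oriented_matroid F1 omM.
have ac1 := restriction_acyclic F1.
have d1 : [disjoint ground p.2 & ground (restriction M F1)] by rewrite gF1.
have n1 : ground (restriction M F1) != set0 by rewrite gF1.
have /= /andP[dF1s pws] := pw.
set p1 := (below F F1, restriction M F1).
have key q : is_facial_free_sum p p1 q ->
  [/\ [/\ oriented_matroid q.2, acyclic q.2 & ground q.2 = ground p.2 :|: F1],
     [/\ ground q.2 != set0, {in q.1, forall D : {set U}, D \subset ground q.2} &
     {in Fs, forall Fi : {set U}, [/\ Fi \in faces M, Fi != set0 & [disjoint ground
       q.2 & Fi]]}],
    forall D, (D \in q.1 :\ ground q.2) = (D \in p.1 :\ ground p.2) || (D \in below F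
      F1 :\ F1)
    & forall G, (G \in proper_faces q.2) =
        [&& G \subset ground q.2, G :&: ground p.2 \in proper_faces p.2
          & G :&: F1 \in proper_faces (restriction M F1)]].
  move=> [q1 hq]; have [omq acq gq facesq] := free_sumP omp om1 acp ac1 pn0 n1 d1 hq.
  have gp1 : ground p1.2 = F1 := gF1.
  rewrite gp1 in gq; rewrite gF1 in facesq.
  have subD D : D \in below F F1 -> D \subset F1 by rewrite inE => /andP[].
  split=> //; last by move=> G; rewrite facesq gq.
    rewrite gq; split.
    - by apply: contraNneq pn0 => E; rewrite -subset0 -E subsetUl.
    - move=> D; rewrite q1 /box_building gp1 !inE => /orP[/orP[]|/eqP->] //.
        by move=> /andP[_ /pS DS]; apply: subset_trans DS (subsetUl _ _).
      by move=> /and3P[_ _ DS]; apply: subset_trans DS (subsetUr _ _).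
    move=> Fi Fis; have [|? ? dpi] := FsP Fi; first by rewrite in_cons Fis orbT.
    split=> //; rewrite -setI_eq0 setIUl (disjoint_setI0 dpi) set0U setI_eq0.
    exact: (allP dF1s).
  move=> D; rewrite q1 /box_building gp1 in_setD1 !in_setU in_set1 gq.
  rewrite !in_setD1; case: (eqVneq D (ground p.2 :|: F1)) => [DE|_] /=;
    last by rewrite orbF.
  have /set0Pn[e eF1] := F1n0; have /set0Pn[f fp] := pn0.
  have nDp : (D \in p.1) = false.
    apply/negbTE/negP => /pS/subsetP/(_ e);
      rewrite DE inE eF1 orbT (disjointFl dF1 eF1).
    by move=> /(_ isT).
  have nD1 : (D \in below F F1) = false.
    apply/negbTE/negP => /subD/subsetP/(_ f); rewrite DE inE fp (disjointFr dF1 fp).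
    by move=> /(_ isT).
  by rewrite nDp nD1 !andbF.
split.
  have [P hP] := free_sum_exists omp om1 acp ac1 pn0 n1 d1.
  have [[omq acq _] [qn0 qS qFs] _ _] := key (box_building p p1, P) (conj erefl hP).
  have [[r hr] _] := IHs (box_building p p1, P) omq acq qn0 qS qFs pws.
  by exists r, (box_building p p1, P).
move=> r [q /key[[omq acq gq] [qn0 qS qFs] q1 facesq] hr].
have [_ /(_ r hr)[omr acr gr r1 facesr]] := IHs q omq acq qn0 qS qFs pws.
split=> //.
- by move=> e; rewrite gr gq in_setU orbA.
- by move=> D; rewrite r1 q1 orbA.
move=> G; rewrite facesr facesq; case GS: (G \subset ground r.2) => //=.
rewrite subsetIr /= gq -!setIA.
have -> : (ground p.2 :|: F1) :&: ground p.2 = ground p.2 by rewrite setUK.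
have -> : (ground p.2 :|: F1) :&: F1 = F1 by rewrite setIC setKU.
by rewrite andbA.
Qed.

End IteratedFreeSum.

(** * Nested sets of the free sum *)

Section Assembly.
Variables (U : finType) (M : covector_system U) (F : {set {set U}}).
Hypotheses (omM : oriented_matroid M) (acM : acyclic M).
Hypothesis bsF : facial_building_set (F, M).
Implicit Types (A : {set {set U}}) (B C D G J : {set U}) (s : seq {set U}).

Let kF B : B \in kappa F -> B \in F.
Proof. exact/subsetP/kappa_subset. Qed.

Section FreeSum.
(* The iterated free sum enters only through its ground set, its building set
   and its proper faces. *)
Variable r : facial_pair U.
Hypotheses (omr : oriented_matroid r.2) (acr : acyclic r.2).
Hypothesis groundr :
  forall e, e \in ground r.2 <-> exists2 B, B \in kappa F & e \in B.
Hypothesis buildr : r.1 :\ ground r.2 = F :\: kappa F.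
Hypothesis facesr : forall G, G \in proper_faces r.2 <->
  G \subset ground r.2 /\
  forall B, B \in kappa F -> G :&: B \in faces M /\ G :&: B <> B.

Let kground B : B \in kappa F -> B \subset ground r.2.
Proof. by move=> Bk; apply/subsetP => e eB; apply/groundr; exists B. Qed.

Let Fground D : D \in F -> D \subset ground r.2.
Proof. by move=> /kappa_above[B /kground Br DB]; exact: subset_trans Br. Qed.

Let inner D B : D \in F :\: kappa F -> B \in kappa F -> D \subset B -> D != B.
Proof. by rewrite in_setD => /andP[+ _] Bk _; apply: contraNneq => ->. Qed.

(** A member of F below the factor C, and different from C, meets the other
    factors in the empty face. *)
Lemma inner_proper_face D : D \in F :\: kappa F -> D \in proper_faces r.2 /\ D != set0.
Proof.
move=> DF'; have DF : D \in F by move: DF'; rewrite in_setD => /andP[].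
have [DM Dn0] := building_faces bsF DF; split=> //.
apply/facesr; split=> [|B Bk]; first exact: Fground.
have [C Ck DC] := kappa_above DF.
have [BM Bn0] := building_faces bsF (kF Bk).
have [BC | BC] := eqVneq B C.
  by rewrite BC (setIidPl DC); split=> //; apply/eqP; exact: inner.
have -> : D :&: B = set0.
  apply/eqP; rewrite -subset0 -(kappa_disjoint omM acM bsF Bk Ck BC) setIC.
  exact: setIS.
by split; [exact/acyclic_set0 | apply/eqP; rewrite eq_sym].
Qed.

(** In particular every vertex of the free sum is subdivided, which is why no
    old element remains in a proper face of the iterated subdivision. *)
Lemma proper_face_contains_inner G : G \in proper_faces r.2 -> G != set0 ->
  exists2 D, D \in F :\: kappa F & D \subset G.
Proof.
move=> /facesr[GS GF] /set0Pn[e eG].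
have /groundr[B Bk eB] := subsetP GS e eG.
have [GBM GBn] := GF B Bk.
have [|D DF DG] := building_below acM bsF GBM.
  by apply/set0Pn; exists e; rewrite inE eG.
exists D; last exact: subset_trans DG (subsetIl _ _).
rewrite in_setD DF andbT; apply/negP => /kappaP[_ Dmax].
have BD : B = D by apply: Dmax (kF Bk) _; exact: subset_trans DG (subsetIr _ _).
by case: GBn; apply/eqP; rewrite eqEsubset subsetIr {1}BD.
Qed.

(** A proper face of the free sum meets the factor above J in a face of M, so
    joins inside that factor are the same in both lattices. *)
Lemma face_contains_join A J R : R \in faces r.2 -> cover A \subset R ->
  J \in F -> is_join (faces M) A J -> J \subset R.
Proof.
move=> RM AR JF /and3P[_ AJ /forall_inP Jmin].
have [RE | /eqP Rn] := eqVneq R (ground r.2); first by rewrite RE Fground.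
have [B Bk JB] := kappa_above JF.
have /facesr[_ /(_ B Bk)[RBM _]] : R \in proper_faces r.2 by apply/proper_facesP.
have := Jmin _ RBM; rewrite subsetI AR (subset_trans AJ JB) => /implyP/(_ isT).
by rewrite subsetI => /andP[].
Qed.

Section Order.
Variable s : seq {set U}.
Hypothesis sE : perm_eq s (enum (F :\: kappa F)).
Hypothesis s_order : pairwise (fun G H : {set U} => ~~ (H \subset G)) s.

Lemma mem_order D : (D \in s) = (D \in F :\: kappa F).
Proof. by rewrite (perm_mem sE) mem_enum. Qed.

Lemma order_split s1 J s2 : s = s1 ++ J :: s2 ->
  {in s1, forall B, ~~ (J \subset B)} /\ {in s2, forall B, ~~ (B \subset J)}.
Proof.
move=> E; move: s_order;
  rewrite E pairwise_cat => /and3P[/allrelP r1 _ /= /andP[/allP r2 _]].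
by split=> B Bs; [apply: r1; rewrite ?mem_head | exact: r2].
Qed.

Let orderS : {in s, forall D : {set U}, D \subset ground r.2}.
Proof. by move=> D; rewrite mem_order in_setD => /andP[_ /Fground]. Qed.

Let set0_face : set0 \in faces r.2.
Proof. exact/acyclic_set0. Qed.

Lemma cover_sub_reached s1 s2 A A' : s = s1 ++ s2 -> A' \subset A -> {subset A' <= s1}
  ->
  cover A' \subset reached r.2 s1 A set0.
Proof.
move=> E AA' As1; rewrite /reached set0U.
apply: subset_trans (_ : cover [set B in A | B \in s1] \subset _).
  apply/bigcupsP => B BA'; apply: bigcup_sup.
  by rewrite inE (subsetP AA') //= As1.
apply: sub_face_closure; apply/bigcupsP => B; rewrite inE => /andP[_ Bs1].
by apply: orderS; rewrite E mem_cat Bs1.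
Qed.

(** Suppose an antichain of at least two members of A has join J in F. Its
    members are strictly smaller than J, so the walk has passed all of them
    when it comes to J, and its current face contains their join J. If J is a
    maximal member of F, it is the final face of the walk that contains J, and
    this face cannot be proper. *)
Lemma walk_no_join A : A \subset F :\: kappa F -> walk r.2 s A set0 ->
  no_join_of_antichain M F A.
Proof.
move=> AF /(walkP omr A set0_face orderS)[before final] A' A'A c1 ac J JF.
apply/negP => jJ; have [_ A'J _] := and3P jJ.
have [B Bk JB] := kappa_above JF.
have A's : {subset A' <= s} by move=> C /(subsetP A'A) /(subsetP AF); rewrite mem_order.
have reachedM s1 : reached r.2 s1 A set0 \in faces r.2 by exact: face_closure_face.
have [JBE | JBn] := eqVneq J B.
  have /facesr[_ /(_ B Bk)[_]] : reached r.2 s A set0 \in proper_faces r.2.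
    by apply/proper_facesP.
  apply; apply/setIidPr; rewrite -JBE.
  apply: face_contains_join jJ => //.
  by apply: (@cover_sub_reached s [::]); rewrite ?cats0.
have Js : J \in s.
  rewrite mem_order in_setD JF andbT; apply/negP => /kappaP[_ /(_ B (kF Bk) JB)] BJ.
  by rewrite BJ eqxx in JBn.
have [s1 [s2 E]] : exists s1 s2, s = s1 ++ J :: s2.
  by case/splitPr: Js => s1 s2; exists s1, s2.
case/negP: (before s1 J s2 E).
apply: face_contains_join jJ => //; apply: (cover_sub_reached E A'A) => C CA'.
have CJ : C \subset J by apply: subset_trans A'J; exact: bigcup_sup.
have := A's C CA'; rewrite E mem_cat in_cons => /or3P[//|/eqP CE|Cs2].
  have [D DA' DC] : exists2 D, D \in A' & D != C.
    move: c1; rewrite (cardsD1 C) CA' ltnS card_gt0 => /set0Pn[D].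
    by rewrite in_setD1 => /andP[DC DA']; exists D.
  have DJ : D \subset C by rewrite CE; apply: subset_trans A'J; exact: bigcup_sup.
  move/forall_inP/(_ D DA')/forall_inP/(_ C CA'): ac.
  by rewrite DJ (negbTE DC).
by have [_ /(_ C Cs2)] := order_split E; rewrite CJ.
Qed.

(** The join of A in the free sum is the union of the joins taken within each
    factor. None of these fills its factor, and they contain no member of F
    that is not below a member of A: both follow from nested_below_closure. *)
Lemma summandwise_closure A : A \subset F :\: kappa F -> no_join_of_antichain M F A ->
  exists W, [/\ W \in proper_faces r.2, cover A \subset W &
    forall J, J \in F -> J \subset W -> exists2 C, C \in A & J \subset C].
Proof.
move=> AF njA.
have AF0 : A \subset F by apply: subset_trans AF (subsetDl _ _).
pose X B := face_closure M (cover [set C in A | C \subset B]).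
have XM B : X B \in faces M by exact: face_closure_face.
have XB B : B \in kappa F -> X B \subset B.
  move=> /kF/(building_faces bsF)[BM _]; apply: face_closure_min => //.
  by apply/bigcupsP => C; rewrite inE => /andP[].
have below_A B J : J \in F -> J \subset X B -> exists2 C, C \in A & J \subset C.
  move=> JF JX; have sA : [set C in A | C \subset B] \subset A.
    by apply/subsetP => C; rewrite inE => /andP[].
  have [C] := nested_below_closure omM acM bsF (subset_trans sA AF0)
    (no_join_of_antichainS sA njA) JF JX.
  by move=> /(subsetP sA) CA JC; exists C.
(* As the factors are disjoint, W meets each of them exactly in its own join. *)
pose W := \bigcup_(B in kappa F) X B.
have WB B : B \in kappa F -> W :&: B = X B.
  move=> Bk; apply/eqP; rewrite eqEsubset subsetI XB // (bigcup_sup B Bk) !andbT.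
  apply/subsetP => e /setIP[/bigcupP[C Ck eX] eB].
  have [<- //|CB] := eqVneq C B.
  have : e \in C :&: B by rewrite inE eB (subsetP (XB C Ck)).
  by rewrite (kappa_disjoint omM acM bsF) // inE.
exists W; split.
- apply/facesr; split=> [|B Bk]; first by apply/bigcupsP => B Bk;
  exact: subset_trans (XB B Bk) (kground Bk).
  rewrite WB //; split=> // XE.
  have [|C CA BC] := below_A B B (kF Bk); first by rewrite XE.
  have := subsetP AF C CA; rewrite in_setD => /andP[Ck CF].
  by have /kappaP[_ /(_ C CF BC) CB] := Bk; rewrite CB Bk in Ck.
- apply/bigcupsP => C CA; have CF := subsetP AF0 C CA.
  have [B Bk CB] := kappa_above CF.
  apply: subset_trans (bigcup_sup B Bk).
  apply: subset_trans (_ : cover [set C in A | C \subset B] \subset _).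
    by apply: bigcup_sup; rewrite inE CA.
  apply: sub_face_closure; apply/bigcupsP => D;
    rewrite inE => /andP[/(subsetP AF0) + _].
  exact: building_ground.
move=> J JF JW; have [B Bk JB] := kappa_above JF.
by apply: (below_A B) => //; rewrite -WB // subsetI JW.
Qed.

(** If the walk found J inside the current face, then J would lie below a
    member of A already passed, which the order of s excludes. *)
Lemma no_join_walk A : A \subset F :\: kappa F -> no_join_of_antichain M F A ->
  walk r.2 s A set0.
Proof.
move=> AF njA; apply/(walkP omr A set0_face orderS).
have reachedW s1 : exists2 W, W \in proper_faces r.2 & reached r.2 s1 A set0 \subset W
  /\
    forall J, J \in F -> J \subset W ->
      exists2 C, (C \in A) && (C \in s1) & J \subset C.
  have sA : [set B in A | B \in s1] \subset A by apply/subsetP => C;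
    rewrite inE => /andP[].
  have [W [Wp AW hW]] := summandwise_closure (subset_trans sA AF)
    (no_join_of_antichainS sA njA).
  exists W => //; split; last by move=> J JF /(hW J JF)[C]; rewrite inE; exists C.
  by rewrite /reached set0U; apply: face_closure_min => //; have /proper_facesP[] := Wp.
split=> [s1 J s2 E|E].
  have [W _ [RW hW]] := reachedW s1.
  have JF : J \in F.
    have : J \in s by rewrite E mem_cat mem_head orbT.
    by rewrite mem_order in_setD => /andP[].
  apply/negP => JR; have [C /andP[_ Cs1] JC] := hW J JF (subset_trans JR RW).
  by have [/(_ C Cs1)] := order_split E; rewrite JC.
have [W /proper_facesP[/facesP[WS _] Wn] [RW _]] := reachedW s.
by case: Wn; apply/eqP; rewrite eqEsubset WS -{1}E.
Qed.

(** The proper faces of the full subdivision are the nested sets: no old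
    element survives, by proper_face_contains_inner, and the walk from the
    empty face succeeds exactly on nested sets. *)
Lemma subdivision_proper_faces N : is_iterated_subdivision s r.2 N ->
  [/\ oriented_matroid N, acyclic N, inr @: (F :\: kappa F) \subset ground N &
  forall K, (K \in proper_faces N) =
    (inl @^-1: K == set0) && (inr @^-1: K \in nested_complex (faces M) F)].
Proof.
have us : uniq s by rewrite (perm_uniq sE) enum_uniq.
move=> /(iterated_subdivisionP omr acr us orderS)[omN acN gN facesN]; split=> //.
  rewrite gN; apply: subset_trans (subsetUr _ _); apply: imsetS.
  by apply/subsetP => D DF'; rewrite in_set mem_order.
move=> K; rewrite facesN;
  apply/and3P/andP => [[GM As wA] | [/eqP G0 /nested_complexP[AF njA]]].
  have AF : inr @^-1: K \subset F :\: kappa F.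
    by apply/subsetP => D /(subsetP As); rewrite mem_order.
  have w0 : walk r.2 s set0 (inl @^-1: K).
    apply: walkS wA => //; first by move=> D _; rewrite inE.
    by have /facesP[] := GM.
  have G0 : inl @^-1: K = set0.
    move: w0; rewrite walk0 => /andP[/allP sG /eqP Gn].
    apply/eqP; apply: contraT => Gn0.
    have [|D DF DG] := proper_face_contains_inner _ Gn0; first by apply/proper_facesP.
    by have := sG D; rewrite mem_order DF DG => /(_ isT).
  rewrite G0; split=> //; apply/nested_complexP; split=> //.
  by apply: walk_no_join; rewrite -?G0.
rewrite G0; split=> //; last exact: no_join_walk.
by apply/subsetP => D /(subsetP AF); rewrite -mem_order.
Qed.

End Order.

Lemma sd_face_semilattice Q : F :\: kappa F != set0 -> is_sd r Q ->
  face_semilattice Q = facial_nested_complex (F, M).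
Proof.
move=> F'n0 [s [N]]; rewrite buildr => -[sE ord hN ->].
have us : uniq s by rewrite (perm_uniq sE) enum_uniq.
have pw : pairwise (fun G H : {set U} => ~~ (H \subset G)) s.
  apply/(pairwiseP set0) => i j; rewrite !inE => si sj ij; apply/negP => sub.
  have := ord _ _ (mem_nth set0 sj) (mem_nth set0 si) sub.
  by rewrite !index_uniq // leqNgt ij.
have [omN acN FN facesN] := subdivision_proper_faces sE pw hN.
have inrI : injective (@inr U {set U}) by move=> ? ? [].
rewrite face_semilattice_new_elements //.
  apply/setP => A; rewrite inE facesN preimset_imset //.
  have -> : inl @^-1: (inr @: A) = set0 :> {set U}.
    by apply/setP => e; rewrite !inE; apply/imsetP => -[].
  by rewrite eqxx.
move=> K; rewrite facesN => /andP[/eqP G0 /nested_complexP[AF _]].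
rewrite [K]elementsE /elements G0 imset0 set0U; exact: imsetS.
Qed.

(** Ordering the faces by cardinality is a valid order of subdivision. *)
Lemma sd_exists : exists Q, is_sd r Q.
Proof.
pose leS (A B : {set U}) := #|A| <= #|B|.
pose s := sort leS (enum (F :\: kappa F)).
have sE : perm_eq s (enum (F :\: kappa F)) by rewrite perm_sort.
have us : uniq s by rewrite (perm_uniq sE) enum_uniq.
have leS_tr : transitive leS by move=> A B C; exact: leq_trans.
have sorted_s : sorted leS s by apply: sort_sorted => A B; exact: leq_total.
have ord : {in s &, forall G H : {set U}, G \subset H -> index G s <= index H s}.
  move=> G H Gs Hs GH; rewrite leqNgt; apply/negP => lt.
  have cHG := sorted_ltn_index leS_tr sorted_s H G Hs Gs lt.
  have GE : G = H by apply/eqP; rewrite eqEcard GH.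
  by rewrite GE ltnn in lt.
have pw : pairwise (fun G H : {set U} => ~~ (H \subset G)) s.
  apply/(pairwiseP set0) => i j; rewrite !inE => si sj ij; apply/negP => sub.
  have := ord _ _ (mem_nth set0 sj) (mem_nth set0 si) sub.
  by rewrite !index_uniq // leqNgt ij.
have [|N hN] := iterated_subdivision_exists omr acr us _ pw.
  by move=> D; rewrite (mem_order sE); exact: inner_proper_face.
by exists (unrelabel inr (restriction N (inr @: (F :\: kappa F)))), s, N;
  rewrite buildr.
Qed.

End FreeSum.

Lemma nested_complex_trivial : F :\: kappa F = set0 ->
  facial_nested_complex (F, M) = [set set0].
Proof.
move=> F'0; apply/setP => A; rewrite in_set1.
rewrite /facial_nested_complex /=; apply/nested_complexP/eqP => [[]|->];
  first by rewrite F'0 subset0 => /eqP.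
split=> [|A' + c1]; first exact: sub0set.
by rewrite subset0 => /eqP A'0; rewrite A'0 cards0 in c1.
Qed.

End Assembly.

Lemma isomorphic_by_inclusion_eq (U : finType) (A B : {set {set U}}) :
  A = B -> isomorphic_by_inclusion A B.
Proof. by move=> ->; exists id; split=> //; rewrite imset_id. Qed.

Theorem theorem7p3 (U : finType) (M : covector_system U) (F : {set {set U}})
    (Fs : seq {set U}) :
  oriented_matroid M -> acyclic M -> facial_building_set (F, M) ->
  perm_eq Fs (enum (kappa F)) ->
  let summands := [seq (below F Fi, restriction M Fi) | Fi <- Fs] in
  (exists p Q, is_iterated_free_sum summands p /\ is_sd p Q) /\
  (forall p Q, is_iterated_free_sum summands p -> is_sd p Q ->
     isomorphic_by_inclusion
       (facial_nested_complex (F, M)) (face_semilattice Q)).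
Proof.
move=> omM acM bsF FsE summands.
have memFs B : (B \in Fs) = (B \in kappa F) by rewrite (perm_mem FsE) mem_enum.
have uFs : uniq Fs by rewrite (perm_uniq FsE) enum_uniq.
have kF B : B \in kappa F -> B \in F by exact/subsetP/kappa_subset.
have trivial_sd (r : facial_pair U) Q : r.1 :\ ground r.2 = F :\: kappa F ->
    F :\: kappa F = set0 -> is_sd r Q -> face_semilattice Q = facial_nested_complex
      (F, M).
  move=> r1 F'0 [s [N [_ _ _ ->]]]; rewrite r1 F'0 nested_complex_trivial //.
  by rewrite /face_semilattice /= imset0 setI0 preimset0 eqxx.
(* The sum without summands lives on the empty set, and then F is empty too. *)
case FsD: Fs => [|F1 Fs'].
  have k0 : kappa F = set0 by apply/setP => B; rewrite -memFs FsD inE.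
  have F0 : F = set0.
    by apply/setP => D; rewrite inE; apply/negbTE/negP => /kappa_above[B];
      rewrite k0 inE.
  have F'0 : F :\: kappa F = set0 by rewrite F0 set0D.
  have r1 : (set0 : {set {set U}}, empty_om U).1 :\ ground (empty_om U) = F :\: kappa F.
    by rewrite F'0 /= set0D.
  rewrite /summands FsD /=; split.
    exists (set0, empty_om U);
      exists (unrelabel inr (restriction (relabel inl (empty_om U)) (inr @: set0))).
    split=> //; exists [::], (relabel inl (empty_om U)); rewrite /= set0D.
    by split=> //; rewrite enum_set0.
  move=> p Q -> sdQ; apply: isomorphic_by_inclusion_eq.
  exact/esym/(trivial_sd _ _ r1 F'0 sdQ).
have pw : pairwise (fun A B : {set U} => [disjoint A & B]) Fs.
  apply/(pairwiseP set0) => i j; rewrite !inE => si sj ij.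
  rewrite -setI_eq0; apply/eqP/(kappa_disjoint omM acM bsF).
  - by rewrite -memFs mem_nth.
  - by rewrite -memFs mem_nth.
  by rewrite nth_uniq // neq_ltn ij.
have kM B : B \in Fs -> B \in faces M /\ B != set0.
  by rewrite memFs => /kF/(building_faces bsF).
have gB B : B \in Fs -> ground (restriction M B) = B.
  by move=> /kM[/facesP[BS _] _]; apply/setIidPr.
have F1s : F1 \in Fs by rewrite FsD mem_head.
have [F1M F1n0] := kM F1 F1s.
have sub_s B : B \in Fs' -> B \in Fs by rewrite FsD in_cons orbC => ->.
move: (pw); rewrite FsD /= => /andP[dF1 pw'].
have gp : ground (below F F1, restriction M F1).2 = F1 := gB F1 F1s.
have [|||||| [r0 hr0] rP] := @iterated_free_sum_from U M F omM acM Fs' (below F F1,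
  restriction M F1).
- exact: restriction_oriented_matroid.
- exact: restriction_acyclic.
- by rewrite gp.
- by rewrite gp => D; rewrite inE => /andP[].
- by move=> B Bs; have [BM Bn0] := kM B (sub_s B Bs); rewrite gp; split=> //;
  exact: (allP dF1).
- exact: pw'.
rewrite gp in rP.
have summandsE : summands = [seq (below F Fi, restriction M Fi) | Fi <- F1 :: Fs'] by
  rewrite /summands FsD.
have facts r : is_iterated_free_sum summands r ->
  [/\ oriented_matroid r.2, acyclic r.2,
    forall e, e \in ground r.2 <-> exists2 B, B \in kappa F & e \in B,
    r.1 :\ ground r.2 = F :\: kappa F
  & forall G, G \in proper_faces r.2 <->
      G \subset ground r.2 /\
      forall B, B \in kappa F -> G :&: B \in faces M /\ G :&: B <> B].
  rewrite summandsE => /rP[omr acr gr r1 fr]; split=> //.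
  - move=> e;
    rewrite gr -[_ || _]/(has (fun Fi : {set U} => e \in Fi) (F1 :: Fs')) -FsD.
    by split=> [/hasP[B]|[B]]; rewrite -?memFs => Bk eB; [|apply/hasP]; exists B;
      rewrite -?memFs.
  - apply/setP => D;
    rewrite r1 -[_ || _]/(has (fun Fi : {set U} => D \in below F Fi :\ Fi) (F1 ::
      Fs')) -FsD.
    apply/hasP/setDP => [[B] | [DF Dk]].
      rewrite memFs in_setD1 [D \in below _ _]inE => Bk /and3P[DB DF subDB]; split=> //.
      apply/negP => /kappaP[_ /(_ B (kF B Bk) subDB)] BD.
      by rewrite BD eqxx in DB.
    have [B Bk DB] := kappa_above DF; exists B; first by rewrite memFs.
    by rewrite in_setD1 [D \in below _ _]inE DF DB !andbT; apply: contraNneq Dk => ->.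
  move=> G; rewrite fr.
  rewrite -[X in _ && X]/(all (fun Fi => G :&: Fi \in proper_faces (restriction M Fi))
    (F1 :: Fs')) -FsD.
  have restrE B : B \in Fs -> reflect (G :&: B \in faces M /\ G :&: B <> B)
      (G :&: B \in proper_faces (restriction M B)).
    move=> Bs; have [BM _] := kM B Bs.
    apply: (iffP (proper_facesP _ _));
      rewrite faces_restriction // [_ \in below _ _]inE subsetIr andbT gB //.
  split=> [/andP[GS /allP hG] | [GS hG]].
    by split=> // B; rewrite -memFs => Bs; apply/restrE => //; exact: hG.
  by rewrite GS; apply/allP => B Bs; apply/restrE => //; apply: hG; rewrite -memFs.
have hr0' : is_iterated_free_sum summands r0 by rewrite summandsE.
split.
  have [omr acr gr r1 fr] := facts r0 hr0'.
  have [Q hQ] := sd_exists omM acM bsF omr acr gr r1 fr.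
  by exists r0, Q.
move=> p Q /facts[omr acr gr r1 fr] sdQ; apply: isomorphic_by_inclusion_eq; apply/esym.
have [F'0 | F'n0] := eqVneq (F :\: kappa F) set0; first exact: trivial_sd r1 F'0 sdQ.
exact: (sd_face_semilattice omM acM bsF omr acr gr r1 fr).
Qed.
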